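(* Let $f(z)=\sum_{n\ge0} a_n z^{-n}\in\mathbb{C}[[z^{-1}]]$ be a Gevrey-1 formal series with Borel transform $\widetilde f(\zeta)=\sum_{n\ge1} \frac{a_n\zeta^{n-1}}{(n-1)!}$. Let $\lambda>0$ and assume that $\widetilde f$ extends holomorphically to $\Delta_\lambda$ and that there exist $A>0$, $B>0$ with $|\widetilde f(\zeta)|\le A e^{B|\zeta|}$ for all $\zeta\in\Delta_\lambda$. Put $a_n^{(\lambda)}=\lambda^{n-1}a_n$ and $b_n^{(\lambda)}=\frac{1}{n!}\sum_{k=1}^{n+1}(-1)^{n-k+1}\mathfrak{s}(n,k-1)\,a_k^{(\lambda)}$. Then for every $n\ge0$, $$|b_n^{(\lambda)}|\le\frac{A\,(n+\lambda B)^{n+\lambda B}}{(\lambda B)^{\lambda B}\,n^n}$$ (with the convention $0^0=1$).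
   Context: $\Delta$ is the image of the open disc $D(1,1)=\{s:|s-1|<1\}$ under $s\mapsto-\ln s$ (principal logarithm), and $\Delta_\lambda=\{\lambda\zeta:\zeta\in\Delta\}$. Gevrey-1 means $|a_n|\le CK^nn!$ for some constants. Stirling numbers of the first kind: $\prod_{k=0}^{n-1}(x-k)=\sum_{k=0}^n\mathfrak{s}(n,k)x^k$. *)

(* Defs.v *)
From Stdlib Require Import Reals ZArith.
From Coquelicot Require Import Coquelicot.
From mathcomp Require Import all_boot all_algebra.

Definition stirling1_int (n k : nat) : int :=
  ((\prod_(i < n) ('X - (i%:R)%:P) : {poly int})`_k)%R.

Definition int_to_Z (z : int) : Z :=
  match z with
  | Posz m => Z.of_nat m
  | Negz m => Z.opp (Z.of_nat (S m))
  end.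

Definition stirling1 (n k : nat) : R := IZR (int_to_Z (stirling1_int n k)).

Open Scope R_scope.

(* Principal argument in (-PI, PI], and principal logarithm. *)
Definition Carg (z : C) : R :=
  let x := Re z in let y := Im z in
  if Rlt_dec 0 x then atan (y / x)
  else if Rlt_dec x 0 then
         (if Rle_dec 0 y then atan (y / x) + PI else atan (y / x) - PI)
  else if Rlt_dec 0 y then PI / 2
  else if Rlt_dec y 0 then - (PI / 2)
  else 0.

Definition Clog (z : C) : C := (ln (Cmod z), Carg z).

Definition Delta (zeta : C) : Prop :=
  exists s : C, Cmod (s - 1)%C < 1 /\ zeta = (- Clog s)%C.

Definition Delta_lam (lam : R) (w : C) : Prop :=
  exists zeta : C, Delta zeta /\ w = (RtoC lam * zeta)%C.

Definition gevrey1 (a : nat -> C) : Prop :=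
  exists Cst K : R, forall n : nat, Cmod (a n) <= Cst * K ^ n * INR (fact n).

Definition C_holo_at (F : C -> C) (z : C) : Prop :=
  exists l : C, is_derive (K := C_AbsRing) (V := C_NormedModule) F z l.

(* Term of the Borel transform: sum_{n>=1} a_n zeta^(n-1)/(n-1)!, reindexed m = n-1. *)
Definition borel_term (a : nat -> C) (zeta : C) (m : nat) : C :=
  (a (S m) * Cpow zeta m / RtoC (INR (fact m)))%C.

(* a_n^(lambda) = lambda^(n-1) a_n  (used for n >= 1). *)
Definition a_lam (lam : R) (a : nat -> C) (n : nat) : C :=
  (RtoC (lam ^ (n - 1)) * a n)%C.

Definition b_lam (lam : R) (a : nat -> C) (n : nat) : C :=
  (RtoC (/ INR (fact n)) *
   sum_n_m (G := C_AbelianMonoid)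
     (fun k => RtoC ((-1) ^ (n + 1 - k)) * RtoC (stirling1 n (k - 1)) * a_lam lam a k)%C
     1 (n + 1))%C.

(* Main.v *)
(** Put [L (t) = - Clog (1 - t)] and [H (t) = F (lam * L (t))], holomorphic on the unit disc.
    Since [L (t) ^ m / m!] generates the unsigned Stirling numbers, [b_lam n] is the [n]-th
    Taylor coefficient of [H] at 0.  On the circle [|t| = r] one has [|L (t)| <= - ln (1 - r)],
    so Cauchy's estimate gives [|b_lam n| <= A * (1 - r) ^ (- lam B) * r ^ (- n)], and the
    claim is the choice [r = n / (n + lam B)].

    Writing [t = Cexp w], circles become vertical segments of length [2 PI] and functions on the
    disc become periodic, so that Cauchy's formula reduces to Goursat's theorem on rectangles.
    Only finitely many terms of the series of [F] are used: the remainder is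
    [O (|t| ^ (n + 1))] and does not contribute to the [n]-th coefficient. *)

Require Import Defs.
From Stdlib Require Import Reals Factorial Lra Lia ClassicalEpsilon.
From Coquelicot Require Import Coquelicot.
Open Scope R_scope.

(** * Complex derivatives *)

(** No coefficient is read off from an infinite expansion. The [n]-th coefficient is the mean of the
    function times [t ^ (- n)] over a circle, and three facts about such means suffice. They do not
    depend on the radius. They vanish for a function that is [O (|t|)], because the radius can
    shrink to 0; this disposes of the remainder of the truncated series without termwise
    integration.

    The freedom of radius carries the argument: the series represents [F] only near 0, so small
    circles identify the coefficient, while the growth bound holds on all of [Delta_lam lam], so a
    larger circle may be used to estimate it. For [n = 0] the best radius would be 0, which is not a
    circle, and the bound is reached only as a limit. *)

Notation is_Cderive f z l :=
  (is_derive (K := C_AbsRing) (V := C_NormedModule) f z l).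

Lemma is_CderiveP (f : C -> C) (z l : C) :
  is_Cderive f z l <->
  forall eps, 0 < eps -> exists d, 0 < d /\ forall w, Cmod (w - z) < d ->
    Cmod (f w - f z - l * (w - z)) <= eps * Cmod (w - z).
Proof.
  split.
  - intros [_ H] eps Heps.
    destruct (H z (fun P HP => HP) (mkposreal eps Heps)) as [d Hd].
    exists d. split; [apply cond_pos|].
    intros w Hw. specialize (Hd w Hw). simpl in Hd.
    replace (l * (w - z))%C with ((w - z) * l)%C by ring. exact Hd.
  - intros H. split.
    + apply is_linear_scal_l.
    + intros x Hx eps.
      rewrite <- (is_filter_lim_locally_unique (V := AbsRing_NormedModule C_AbsRing) z x Hx).
      clear x Hx.
      destruct (H eps (cond_pos eps)) as [d [Hd Hw]].
      exists (mkposreal d Hd). intros w Hdw. simpl in Hdw.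
      specialize (Hw w Hdw).
      replace (l * (w - z))%C with ((w - z) * l)%C in Hw by ring. exact Hw.
Qed.

(** The rules for products and for inner functions of a composition regard [C] as a module over
    itself, whose uniform structure is not that of [C_NormedModule]. A differential sees its target
    only through the norm, and that is [Cmod] in both cases. *)
Lemma is_Cderive_AbsRing (f : C -> C) (z l : C) :
  is_Cderive f z l <->
  is_derive (K := C_AbsRing) (V := AbsRing_NormedModule C_AbsRing) f z l.
Proof.
  split; intros [_ H]; (split; [apply @is_linear_scal_l|exact H]).
Qed.

Lemma is_Cderive_mult (f g : C -> C) (z l l' : C) :
  is_Cderive f z l -> is_Cderive g z l' ->
  is_Cderive (fun w => f w * g w)%C z (l * g z + f z * l')%C.
Proof. 
  rewrite !is_Cderive_AbsRing. intros Hf Hg.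
  exact (is_derive_mult f g z l l' Hf Hg Cmult_comm).
 Qed.

Lemma is_Cderive_comp (f g : C -> C) (z l l' : C) :
  is_Cderive f (g z) l -> is_Cderive g z l' ->
  is_Cderive (fun w => f (g w)) z (l' * l)%C.
Proof. 
  rewrite (is_Cderive_AbsRing g). intros Hf Hg.
  exact (is_derive_comp (K := C_AbsRing) (V := C_NormedModule) f g z l l' Hf Hg).
 Qed.

Lemma is_Cderive_plus (f g : C -> C) (z l l' : C) :
  is_Cderive f z l -> is_Cderive g z l' ->
  is_Cderive (fun w => f w + g w)%C z (l + l')%C.
Proof. exact (is_derive_plus (K:=C_AbsRing) (V:=C_NormedModule) f g z l l'). Qed.

Lemma is_Cderive_const (c z : C) : is_Cderive (fun _ => c) z (RtoC 0).
Proof. exact (is_derive_const (K:=C_AbsRing) (V:=C_NormedModule) c z). Qed.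

Lemma is_Cderive_id (z : C) : is_Cderive (fun w => w) z (RtoC 1).
Proof. rewrite is_Cderive_AbsRing. exact (is_derive_id (K := C_AbsRing) z). Qed.

Lemma is_Cderive_eq (f : C -> C) (z l l' : C) : is_Cderive f z l -> l = l' -> is_Cderive f z l'.
Proof. intros H <-. exact H. Qed.

(** Taking [eps = 1] gives [|f w - f z| <= (|l| + 1) |w - z|] near [z]. The rest is a change of
    neighbourhoods: [Cmod] balls for the derivative, product balls for [C_UniformSpace]. *)
Lemma is_Cderive_continuous (f : C -> C) (z l : C) :
  is_Cderive f z l -> continuous (T := C_UniformSpace) (U := C_UniformSpace) f z.
Proof.
  intros H P [e He].
  assert (HC : 0 < Cmod l + 1) by (generalize (Cmod_ge_0 l); lra).
  destruct (proj1 (is_CderiveP f z l) H 1 Rlt_0_1) as [d [Hd Hw]].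
  set (d' := Rmin d (e / (Cmod l + 1))).
  assert (Hd' : 0 < d').
  { apply Rmin_glb_lt; [exact Hd|]. apply Rdiv_lt_0_compat; [apply cond_pos|exact HC]. }
  apply (proj2 (locally_C z (fun w => P (f w)))).
  exists (mkposreal d' Hd'). intros w Hdw. simpl in Hdw.
  change (Cmod (w - z) < d') in Hdw.
  apply He. apply C_NormedModule_mixin_compat1.
  change (Cmod (f w - f z) < e).
  assert (H1 : Cmod (w - z) < d) by (eapply Rlt_le_trans; [exact Hdw|apply Rmin_l]).
  assert (H2 : Cmod (w - z) < e / (Cmod l + 1)) by (eapply Rlt_le_trans; [exact Hdw|apply Rmin_r]).
  specialize (Hw w H1).
  replace (f w - f z)%C with ((f w - f z - l * (w - z)) + l * (w - z))%C by ring.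
  eapply Rle_lt_trans; [apply Cmod_triangle|]. rewrite Cmod_mult.
  apply (Rmult_lt_compat_r (Cmod l + 1)) in H2; [|exact HC].
  unfold Rdiv in H2. rewrite Rmult_assoc, Rinv_l in H2 by lra. lra.
Qed.

(** * Contour integrals over rectangles *)

Notation CInt := (RInt (V := C_R_CompleteNormedModule)).
Notation is_CInt := (is_RInt (V := C_R_CompleteNormedModule)).
Notation ex_CInt := (ex_RInt (V := C_R_CompleteNormedModule)).
Notation Ccontinuous g z := (continuous (T := C_UniformSpace) (U := C_UniformSpace) g z).

Lemma is_CInt_bound (f : R -> C) (a b : R) (l : C) (M : R) :
  a <= b -> (forall x, a <= x <= b -> Cmod (f x) <= M) -> is_CInt f a b l ->
  Cmod l <= (b - a) * M.
Proof.
  intros Hab HM Hf. rewrite Cmod_norm.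
  apply (norm_RInt_le_const (V := C_R_NormedModule) f a b); [exact Hab| |exact Hf].
  intros x Hx. rewrite <- Cmod_norm. exact (HM x Hx).
Qed.

Lemma is_CInt_pair (f : R -> C) (a b : R) (l : C) :
  is_CInt f a b l <->
  is_RInt (fun t => Re (f t)) a b (Re l) /\ is_RInt (fun t => Im (f t)) a b (Im l).
Proof.
  split.
  - intros H. split.
    + exact (is_RInt_fct_extend_fst (U := R_NormedModule) (V := R_NormedModule) f a b l H).
    + exact (is_RInt_fct_extend_snd (U := R_NormedModule) (V := R_NormedModule) f a b l H).
  - intros [H1 H2]. destruct l as [l1 l2].
    exact (is_RInt_fct_extend_pair (U := R_NormedModule) (V := R_NormedModule) f a b l1 l2 H1 H2).
Qed.

Lemma is_CInt_plus (f g : R -> C) (a b : R) (lf lg : C) :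
  is_CInt f a b lf -> is_CInt g a b lg ->
  is_CInt (fun t => f t + g t)%C a b (lf + lg)%C.
Proof. exact (is_RInt_plus (V := C_R_CompleteNormedModule) f g a b lf lg). Qed.

Lemma is_CInt_Cmult (f : R -> C) (a b : R) (c l : C) :
  is_CInt f a b l -> is_CInt (fun t => c * f t)%C a b (c * l)%C.
Proof.
  rewrite !is_CInt_pair. intros [H1 H2].
  split; simpl.
  - exact (is_RInt_minus _ _ _ _ _ _ (is_RInt_scal _ _ _ (fst c) _ H1)
             (is_RInt_scal _ _ _ (snd c) _ H2)).
  - exact (is_RInt_plus _ _ _ _ _ _ (is_RInt_scal _ _ _ (fst c) _ H2)
             (is_RInt_scal _ _ _ (snd c) _ H1)).
Qed.

Lemma is_RInt_affine (p q a b : R) :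
  is_RInt (fun x => p + q * x) a b (p * (b - a) + q * ((b ^ 2 - a ^ 2) / 2)).
Proof.
  replace (p * (b - a) + q * ((b ^ 2 - a ^ 2) / 2))
    with (minus (p * b + q * (b ^ 2 / 2)) (p * a + q * (a ^ 2 / 2)))
    by (unfold minus, plus, opp; simpl; field).
  apply (is_RInt_derive (fun x => p * x + q * (x ^ 2 / 2))).
  - intros x _. auto_derive; [exact I|simpl; field].
  - intros x _. apply (ex_derive_continuous (fun x => p + q * x)).
    auto_derive. exact I.
Qed.

Lemma is_CInt_affine (u v : C) (a b : R) :
  is_CInt (fun x => u + v * RtoC x)%C a b
    (u * RtoC (b - a) + v * RtoC ((b ^ 2 - a ^ 2) / 2))%C.
Proof.
  apply is_CInt_pair. split.
  - replace (Re (u * RtoC (b - a) + v * RtoC ((b ^ 2 - a ^ 2) / 2))%C)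
      with (Re u * (b - a) + Re v * ((b ^ 2 - a ^ 2) / 2)) by (unfold Re; simpl; ring).
    eapply is_RInt_ext; [|apply is_RInt_affine]. intros x _; unfold Re; simpl; ring.
  - replace (Im (u * RtoC (b - a) + v * RtoC ((b ^ 2 - a ^ 2) / 2))%C)
      with (Im u * (b - a) + Im v * ((b ^ 2 - a ^ 2) / 2)) by (unfold Im; simpl; ring).
    eapply is_RInt_ext; [|apply is_RInt_affine]. intros x _; unfold Im; simpl; ring.
Qed.

Lemma continuous_horizontal (g : C -> C) (x c : R) :
  Ccontinuous g (x, c) -> continuous (U := C_R_CompleteNormedModule) (fun t => g (t, c)) x.
Proof.
  intros H. apply (continuous_comp (V := C_UniformSpace) (fun t => (t, c)) g x); [|exact H].
  intros P [e He]. exists e. intros y Hy. apply He. split; [exact Hy|apply ball_center].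
Qed.

Lemma continuous_vertical (g : C -> C) (a y : R) :
  Ccontinuous g (a, y) -> continuous (U := C_R_CompleteNormedModule) (fun t => g (a, t)) y.
Proof.
  intros H. apply (continuous_comp (V := C_UniformSpace) (fun t => (a, t)) g y); [|exact H].
  intros P [e He]. exists e. intros z Hz. apply He. split; [apply ball_center|exact Hz].
Qed.

Definition hint (g : C -> C) (c a b : R) : C := CInt (fun x => g (x, c)) a b.
Definition vint (g : C -> C) (a c d : R) : C := CInt (fun y => g (a, y)) c d.
(** The contour integral along the boundary, counterclockwise; [Ci] comes from [dz = i dy] on the
    vertical sides. *)
Definition rect (g : C -> C) (a b c d : R) : C :=
  (hint g c a b + Ci * vint g b c d - hint g d a b - Ci * vint g a c d)%C.

Definition cont_rect (g : C -> C) (a b c d : R) : Prop :=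
  forall x y, a <= x <= b -> c <= y <= d -> Ccontinuous g (x, y).

Lemma ex_hint (g : C -> C) (a b c d y s t : R) :
  cont_rect g a b c d -> c <= y <= d -> a <= s -> s <= t -> t <= b ->
  ex_CInt (fun x => g (x, y)) s t.
Proof.
  intros H Hy Hs Hst Ht. apply ex_RInt_continuous. intros x.
  rewrite Rmin_left, Rmax_right by lra. intros Hx.
  apply continuous_horizontal. apply H; lra.
Qed.

Lemma ex_vint (g : C -> C) (a b c d x s t : R) :
  cont_rect g a b c d -> a <= x <= b -> c <= s -> s <= t -> t <= d ->
  ex_CInt (fun y => g (x, y)) s t.
Proof.
  intros H Hy Hs Hst Ht. apply ex_RInt_continuous. intros y.
  rewrite Rmin_left, Rmax_right by lra. intros Hx.
  apply continuous_vertical. apply H; lra.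
Qed.

Lemma hint_Chasles (g : C -> C) (a m b c d y : R) :
  cont_rect g a b c d -> c <= y <= d -> a <= m <= b ->
  hint g y a b = (hint g y a m + hint g y m b)%C.
Proof.
  intros H Hy Hm. unfold hint. symmetry.
  apply (RInt_Chasles (V := C_R_CompleteNormedModule));
    apply (ex_hint g a b c d); try assumption; lra.
Qed.

Lemma vint_Chasles (g : C -> C) (a b c m d x : R) :
  cont_rect g a b c d -> a <= x <= b -> c <= m <= d ->
  vint g x c d = (vint g x c m + vint g x m d)%C.
Proof.
  intros H Hy Hm. unfold vint. symmetry.
  apply (RInt_Chasles (V := C_R_CompleteNormedModule));
    apply (ex_vint g a b c d); try assumption; lra.
Qed.

(** Each inner side is traversed twice, in opposite directions. *)
Lemma rect_quarter (g : C -> C) (a m b c k d : R) :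
  cont_rect g a b c d -> a <= m <= b -> c <= k <= d ->
  rect g a b c d =
  (rect g a m c k + rect g m b c k + rect g a m k d + rect g m b k d)%C.
Proof.
  intros H Hm Hk. unfold rect.
  rewrite (hint_Chasles g a m b c d c), (hint_Chasles g a m b c d d),
    (vint_Chasles g a b c k d a), (vint_Chasles g a b c k d b) by (assumption || lra).
  ring.
Qed.

Lemma hint_near_affine (g : C -> C) (u v : C) (a b c M : R) :
  a <= b -> ex_CInt (fun x => g (x, c)) a b ->
  (forall x, a <= x <= b -> Cmod (g (x, c) - (u + v * (x, c))) <= M) ->
  Cmod (hint g c a b - ((u + v * (0, c)) * RtoC (b - a) + v * RtoC ((b ^ 2 - a ^ 2) / 2)))
    <= (b - a) * M.
Proof.
  intros Hab Hex HM.
  apply (is_CInt_bound (fun x => g (x, c) - ((u + v * (0, c)) + v * RtoC x))%C);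
    [exact Hab| |].
  - intros x Hx. replace ((u + v * (0, c)) + v * RtoC x)%C with (u + v * (x, c))%C.
    + exact (HM x Hx).
    + apply injective_projections; simpl; ring.
  - apply (is_RInt_minus (V := C_R_CompleteNormedModule)).
    + exact (RInt_correct (V := C_R_CompleteNormedModule) _ _ _ Hex).
    + apply is_CInt_affine.
Qed.

Lemma vint_near_affine (g : C -> C) (u v : C) (a c d M : R) :
  c <= d -> ex_CInt (fun y => g (a, y)) c d ->
  (forall y, c <= y <= d -> Cmod (g (a, y) - (u + v * (a, y))) <= M) ->
  Cmod (vint g a c d - ((u + v * (a, 0)) * RtoC (d - c) + (v * Ci) * RtoC ((d ^ 2 - c ^ 2) / 2)))
    <= (d - c) * M.
Proof.
  intros Hab Hex HM.
  apply (is_CInt_bound (fun y => g (a, y) - ((u + v * (a, 0)) + (v * Ci) * RtoC y))%C);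
    [exact Hab| |].
  - intros y Hy. replace ((u + v * (a, 0)) + (v * Ci) * RtoC y)%C with (u + v * (a, y))%C.
    + exact (HM y Hy).
    + apply injective_projections; simpl; ring.
  - apply (is_RInt_minus (V := C_R_CompleteNormedModule)).
    + exact (RInt_correct (V := C_R_CompleteNormedModule) _ _ _ Hex).
    + apply is_CInt_affine.
Qed.

(** The integral of an affine function around a rectangle is zero, which the closing [field] checks
    on the explicit side integrals. What is left is the deviation, at most [M], integrated over the
    perimeter. *)
Lemma rect_near_affine (g : C -> C) (u v : C) (a b c d M : R) :
  a <= b -> c <= d -> cont_rect g a b c d ->
  (forall x y, a <= x <= b -> c <= y <= d ->
     Cmod (g (x, y) - (u + v * (x, y))) <= M) ->
  Cmod (rect g a b c d) <= 2 * ((b - a) + (d - c)) * M.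
Proof.
  intros Hab Hcd Hc HM.
  assert (H1 := hint_near_affine g u v a b c M Hab
    (ex_hint g a b c d c a b Hc ltac:(lra) ltac:(lra) ltac:(lra) ltac:(lra))
    ltac:(intros x Hx; apply HM; lra)).
  assert (H2 := hint_near_affine g u v a b d M Hab
    (ex_hint g a b c d d a b Hc ltac:(lra) ltac:(lra) ltac:(lra) ltac:(lra))
    ltac:(intros x Hx; apply HM; lra)).
  assert (H3 := vint_near_affine g u v a c d M Hcd
    (ex_vint g a b c d a c d Hc ltac:(lra) ltac:(lra) ltac:(lra) ltac:(lra))
    ltac:(intros x Hx; apply HM; lra)).
  assert (H4 := vint_near_affine g u v b c d M Hcd
    (ex_vint g a b c d b c d Hc ltac:(lra) ltac:(lra) ltac:(lra) ltac:(lra))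
    ltac:(intros x Hx; apply HM; lra)).
  unfold rect.
  match type of H1 with Cmod ?z <= _ => set (z1 := z) in * end.
  match type of H2 with Cmod ?z <= _ => set (z2 := z) in * end.
  match type of H3 with Cmod ?z <= _ => set (z3 := z) in * end.
  match type of H4 with Cmod ?z <= _ => set (z4 := z) in * end.
  replace (hint g c a b + Ci * vint g b c d - hint g d a b - Ci * vint g a c d)%C
    with (z1 + Ci * z4 + - z2 + - (Ci * z3))%C.
  - eapply Rle_trans; [apply Cmod_triangle|]. rewrite Cmod_opp, Cmod_mult, Cmod_Ci.
    generalize (Cmod_triangle (z1 + Ci * z4) (- z2)), (Cmod_triangle z1 (Ci * z4)).
    rewrite Cmod_opp, Cmod_mult, Cmod_Ci. lra.
  - unfold z1, z2, z3, z4. apply injective_projections; simpl; field.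
Qed.

(** * Goursat's theorem *)

Lemma nested_intervals (l r : nat -> R) :
  (forall n, l n <= l (S n)) -> (forall n, r (S n) <= r n) -> (forall n, l n <= r n) ->
  exists u, forall n, l n <= u <= r n.
Proof.
  intros Hl Hr Hlr.
  assert (Hl' : forall n k, l n <= l (n + k)%nat).
  { intros n k. induction k as [|k IH]; [rewrite Nat.add_0_r; lra|].
    rewrite Nat.add_succ_r. specialize (Hl (n + k)%nat). lra. }
  assert (Hr' : forall n k, r (n + k)%nat <= r n).
  { intros n k. induction k as [|k IH]; [rewrite Nat.add_0_r; lra|].
    rewrite Nat.add_succ_r. specialize (Hr (n + k)%nat). lra. }
  assert (Hm : forall n m, l n <= r m).
  { intros n m. apply Rle_trans with (l (n + m)%nat); [apply Hl'|].
    apply Rle_trans with (r (n + m)%nat); [apply Hlr|]. rewrite Nat.add_comm. apply Hr'. }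
  destruct (completeness (fun x => exists n, x = l n)) as [u [Hu1 Hu2]].
  - exists (r 0%nat). intros x [n ->]. apply Hm.
  - exists (l 0%nat). exists 0%nat. reflexivity.
  - exists u. intros n. split.
    + apply Hu1. exists n. reflexivity.
    + apply Hu2. intros x [m ->]. apply Hm.
Qed.

Lemma Cmod_le_abs (z : C) : Cmod z <= Rabs (Re z) + Rabs (Im z).
Proof.
  replace z with (RtoC (Re z) + Ci * RtoC (Im z))%C at 1
    by (apply injective_projections; simpl; unfold Re, Im; ring).
  eapply Rle_trans; [apply Cmod_triangle|].
  rewrite Cmod_mult, Cmod_Ci, !Cmod_R. lra.
Qed.

Lemma rect_big_quarter (g : C -> C) (x y W K E : R) :
  0 <= W -> 0 <= K -> cont_rect g x (x + W) y (y + K) ->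
  E <= Cmod (rect g x (x + W) y (y + K)) ->
  exists p : R * R,
    (x <= fst p /\ fst p + W / 2 <= x + W) /\
    (y <= snd p /\ snd p + K / 2 <= y + K) /\
    E / 4 <= Cmod (rect g (fst p) (fst p + W / 2) (snd p) (snd p + K / 2)).
Proof.
  intros HW HK Hc HE.
  rewrite (rect_quarter g x (x + W / 2) (x + W) y (y + K / 2) (y + K)) in HE
    by (assumption || lra).
  assert (Hx : x + W / 2 + W / 2 = x + W) by field.
  assert (Hy : y + K / 2 + K / 2 = y + K) by field.
  match type of HE with
  | _ <= Cmod (?z1 + ?z2 + ?z3 + ?z4)%C =>
    generalize (Cmod_triangle (z1 + z2 + z3) z4) (Cmod_triangle (z1 + z2) z3)
      (Cmod_triangle z1 z2); intros T1 T2 T3;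
    destruct (Rle_dec (E / 4) (Cmod z1)) as [H1|H1];
    [|destruct (Rle_dec (E / 4) (Cmod z2)) as [H2|H2];
    [|destruct (Rle_dec (E / 4) (Cmod z3)) as [H3|H3]]]
  end.
  - exists (x, y). simpl. repeat split; try lra; exact H1.
  - exists (x + W / 2, y). simpl. rewrite Hx. repeat split; try lra; exact H2.
  - exists (x, y + K / 2). simpl. rewrite Hy. repeat split; try lra; exact H3.
  - exists (x + W / 2, y + K / 2). simpl. rewrite Hx, Hy. repeat split; lra.
Qed.

(** The rectangle of stage [n] is recorded by its lower left corner, its sides being [W / 2 ^ n] and
    [K / 2 ^ n]. Each bisection keeps a quarter with at least a fourth of the integral. *)
Lemma rect_nested (g : C -> C) (a W c K : R) :
  0 <= W -> 0 <= K -> cont_rect g a (a + W) c (c + K) ->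
  exists x y : nat -> R, forall n,
    (a <= x n /\ x n + W / 2 ^ n <= a + W) /\
    (c <= y n /\ y n + K / 2 ^ n <= c + K) /\
    (x n <= x (S n) /\ x (S n) + W / 2 ^ S n <= x n + W / 2 ^ n) /\
    (y n <= y (S n) /\ y (S n) + K / 2 ^ S n <= y n + K / 2 ^ n) /\
    Cmod (rect g a (a + W) c (c + K)) / 4 ^ n <=
      Cmod (rect g (x n) (x n + W / 2 ^ n) (y n) (y n + K / 2 ^ n)).
Proof.
  intros HW HK Hc.
  set (E := Cmod (rect g a (a + W) c (c + K))).
  set (bad := fun (n : nat) (p : R * R) =>
    (a <= fst p /\ fst p + W / 2 ^ n <= a + W) /\
    (c <= snd p /\ snd p + K / 2 ^ n <= c + K) /\
    E / 4 ^ n <= Cmod (rect g (fst p) (fst p + W / 2 ^ n) (snd p) (snd p + K / 2 ^ n))).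
  set (sub := fun (n : nat) (p q : R * R) =>
    (fst p <= fst q /\ fst q + W / 2 ^ S n <= fst p + W / 2 ^ n) /\
    (snd p <= snd q /\ snd q + K / 2 ^ S n <= snd p + K / 2 ^ n)).
  assert (Hstep : forall n p, bad n p -> exists q, bad (S n) q /\ sub n p q).
  { intros n p [Hx [Hy HE]].
    assert (H2 : 0 < 2 ^ n) by (apply pow_lt; lra).
    assert (HWn : 0 <= W / 2 ^ n) by (apply Rdiv_le_0_compat; lra).
    assert (HKn : 0 <= K / 2 ^ n) by (apply Rdiv_le_0_compat; lra).
    destruct (rect_big_quarter g (fst p) (snd p) (W / 2 ^ n) (K / 2 ^ n) (E / 4 ^ n))
      as [q [Hq1 [Hq2 Hq3]]]; try assumption.
    { intros s t Hs Ht. apply Hc; lra. }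
    assert (EW : W / 2 ^ n / 2 = W / 2 ^ S n) by (simpl; field; lra).
    assert (EK : K / 2 ^ n / 2 = K / 2 ^ S n) by (simpl; field; lra).
    assert (EE : E / 4 ^ n / 4 = E / 4 ^ S n).
    { simpl; field. apply pow_nonzero. lra. }
    rewrite EW in Hq1, Hq3. rewrite EK in Hq2, Hq3. rewrite EE in Hq3.
    exists q. unfold bad, sub. repeat split; try lra. }
  (* Dependent choice: [epsilon] makes the selection a total function, so [s] is a plain recursion
     on corners and [bad] is proved along it afterwards. *)
  set (next := fun n p => epsilon (inhabits p) (fun q => bad (S n) q /\ sub n p q)).
  set (s := fix s n := match n with O => (a, c) | S m => next m (s m) end).
  assert (Hs : forall n, bad n (s n)).
  { induction n as [|n IH].
    - unfold bad. simpl. rewrite !Rdiv_1_r. fold E. repeat split; lra.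
    - exact (proj1 (epsilon_spec (inhabits (s n)) _ (Hstep n (s n) IH))). }
  exists (fun n => fst (s n)), (fun n => snd (s n)). intros n.
  destruct (Hs n) as [H1 [H2 H3]].
  destruct (epsilon_spec (inhabits (s n)) _ (Hstep n (s n) (Hs n))) as [_ [H4 H5]].
  repeat (split; [assumption|]). assumption.
Qed.

Theorem goursat (g : C -> C) (a b c d : R) :
  a <= b -> c <= d ->
  (forall x y, a <= x <= b -> c <= y <= d -> C_holo_at g (x, y)) ->
  rect g a b c d = RtoC 0.
Proof.
  intros Hab Hcd Hg.
  assert (Hc : cont_rect g a b c d).
  { intros x y Hx Hy. destruct (Hg x y Hx Hy) as [l Hl].
    exact (is_Cderive_continuous g _ l Hl). }
  set (W := b - a). set (K := d - c).
  replace b with (a + W) in * by (unfold W; ring).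
  replace d with (c + K) in * by (unfold K; ring).
  assert (HW : 0 <= W) by lra. assert (HK : 0 <= K) by lra.
  destruct (rect_nested g a W c K HW HK Hc) as [x [y Hxy]].
  set (E := Cmod (rect g a (a + W) c (c + K))) in *.
  assert (Hpow : forall n, 0 < 2 ^ n) by (intros n; apply pow_lt; lra).
  assert (HWn : forall n, 0 <= W / 2 ^ n) by (intros n; apply Rdiv_le_0_compat; auto).
  assert (HKn : forall n, 0 <= K / 2 ^ n) by (intros n; apply Rdiv_le_0_compat; auto).
  destruct (nested_intervals x (fun n => x n + W / 2 ^ n)) as [u Hu];
    try (intros n; specialize (Hxy n); specialize (HWn n); lra).
  destruct (nested_intervals y (fun n => y n + K / 2 ^ n)) as [v Hv];
    try (intros n; specialize (Hxy n); specialize (HKn n); lra).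
  destruct (Hg u v) as [l Hl].
  { specialize (Hu O). specialize (Hxy O). simpl in Hu, Hxy. lra. }
  { specialize (Hv O). specialize (Hxy O). simpl in Hv, Hxy. lra. }
  apply Cmod_eq_0. fold E.
  assert (HE0 : 0 <= E) by apply Cmod_ge_0.
  destruct (Rle_lt_or_eq_dec 0 E HE0) as [HE|HE]; [exfalso|now rewrite <- HE].
  (* The summand 1 keeps [D] positive for a degenerate rectangle. *)
  set (D := W + K + 1). assert (HD : 0 < D) by (unfold D; lra).
  (* With [h = / 2 ^ n], the rectangle of stage [n] has integral at least [E * h ^ 2], and the
     affine approximation bounds it by [2 * (W + K) * h * (eta * D * h)]. This [eta] makes the
     latter at most [E / 2 * h ^ 2]. *)
  set (eta := E / (4 * D ^ 2)).
  assert (HD2 : 0 < D ^ 2) by (apply pow_lt; exact HD).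
  assert (Heta : 0 < eta) by (apply Rdiv_lt_0_compat; lra).
  destruct (proj1 (is_CderiveP g (u, v) l) Hl eta Heta) as [del [Hdel Hd]].
  assert (Hn : exists n, D / 2 ^ n < del).
  { destruct (pow_lt_1_zero (/ 2) ltac:(rewrite Rabs_right; lra) (del / D)
      ltac:(apply Rdiv_lt_0_compat; lra)) as [n Hn].
    exists n. specialize (Hn n (le_n n)).
    rewrite Rabs_right in Hn by (apply Rle_ge, pow_le; lra).
    rewrite pow_inv in Hn.
    apply (Rmult_lt_compat_l D) in Hn; [|exact HD].
    replace (D * (del / D)) with del in Hn by (field; lra). exact Hn. }
  destruct Hn as [n Hn].
  specialize (Hxy n). specialize (Hu n). specialize (Hv n). specialize (Hpow n).
  specialize (HWn n). specialize (HKn n). simpl in Hu, Hv.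
  set (h := / 2 ^ n) in *.
  assert (Hh : 0 < h) by (apply Rinv_0_lt_compat; exact Hpow).
  fold h in HWn, HKn, Hn, Hxy, Hu, Hv. unfold Rdiv in HWn, HKn, Hn, Hxy, Hu, Hv.
  fold h in HWn, HKn, Hn, Hxy, Hu, Hv.
  destruct Hxy as [Hx1 [Hy1 [_ [_ HR]]]].
  assert (Hb : Cmod (rect g (x n) (x n + W * h) (y n) (y n + K * h))
     <= 2 * (x n + W * h - x n + (y n + K * h - y n)) * (eta * (D * h))).
  (* The affine function is the first-order expansion of [g] at the point [(u, v)] common to all
     rectangles. *)
  { apply (rect_near_affine g (g (u, v) - l * (u, v)) l); try lra.
    - intros s t Hs Ht. apply Hc; lra.
    - intros s t Hs Ht.
      assert (Hw : Cmod ((s, t) - (u, v)) <= (W + K) * h).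
      { eapply Rle_trans; [apply Cmod_le_abs|]. simpl.
        assert (Rabs (s + - u) <= W * h) by (apply Rabs_le; lra).
        assert (Rabs (t + - v) <= K * h) by (apply Rabs_le; lra). lra. }
      assert (Hw' : (W + K) * h < D * h) by (apply Rmult_lt_compat_r; unfold D; lra).
      specialize (Hd (s, t) ltac:(lra)).
      replace (g (s, t) - (g (u, v) - l * (u, v) + l * (s, t)))%C
        with (g (s, t) - g (u, v) - l * ((s, t) - (u, v)))%C by ring.
      eapply Rle_trans; [exact Hd|]. apply Rmult_le_compat_l; lra. }
  assert (H4 : / 4 ^ n = h * h).
  { unfold h. rewrite <- Rinv_mult, <- Rpow_mult_distr. do 2 f_equal; ring. }
  rewrite H4 in HR.
  assert (Hlt : E * (h * h) <= 2 * ((W + K) * h) * (eta * (D * h))).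
  { eapply Rle_trans; [exact HR|]. eapply Rle_trans; [exact Hb|]. right. ring. }
  replace (2 * ((W + K) * h) * (eta * (D * h))) 
    with ((2 * (W + K) * eta * D) * (h * h)) in Hlt by ring.
  apply Rmult_le_reg_r in Hlt; [|nra].
  assert (2 * (W + K) * eta * D <= 2 * D * eta * D).
  { apply Rmult_le_compat_r; [lra|]. apply Rmult_le_compat_r; [lra|]. unfold D; lra. }
  replace (2 * D * eta * D) with (E / 2) in H by (unfold eta; field; lra).
  lra.
Qed.

(** * Exponential and logarithm *)

(** The Cauchy-Riemann equations are built into the hypotheses: the matrix of partial derivatives is
    that of multiplication by [(p, q)]. Real and imaginary remainders cost [eps / 2] each. *)
Lemma Cauchy_Riemann (u v : R -> R -> R) (x y p q : R) :
  differentiable_pt_lim u x y p (- q) -> differentiable_pt_lim v x y q p ->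
  is_Cderive (fun w => (u (fst w) (snd w), v (fst w) (snd w))) (x, y) (p, q).
Proof.
  intros Hu Hv. apply is_CderiveP. intros eps Heps.
  assert (He2 : 0 < eps / 2) by lra.
  destruct (Hu (mkposreal _ He2)) as [d1 H1]. destruct (Hv (mkposreal _ He2)) as [d2 H2].
  exists (Rmin d1 d2). split; [apply Rmin_glb_lt; apply cond_pos|].
  intros [s t] Hw.
  assert (Hm := Rmax_Cmod ((s, t) - (x, y))%C). simpl in Hm.
  change (s + - x) with (s - x) in Hm. change (t + - y) with (t - y) in Hm.
  assert (Hs := Rmax_l (Rabs (s - x)) (Rabs (t - y))).
  assert (Ht := Rmax_r (Rabs (s - x)) (Rabs (t - y))).
  assert (Hd1 := Rmin_l d1 d2). assert (Hd2 := Rmin_r d1 d2).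
  specialize (H1 s t ltac:(lra) ltac:(lra)). specialize (H2 s t ltac:(lra) ltac:(lra)).
  simpl in H1, H2.
  eapply Rle_trans; [apply Cmod_le_abs|]. simpl.
  match goal with |- Rabs ?a + Rabs ?b <= _ =>
    replace a with (u s t - u x y - (p * (s - x) + - q * (t - y))) by ring;
    replace b with (v s t - v x y - (q * (s - x) + p * (t - y))) by ring end.
  assert (Hm' := Rmult_le_compat_l (eps / 2) _ _ (Rlt_le _ _ He2) Hm). lra.
Qed.

(** Total differentiability follows when one partial derivative exists nearby and is continuous at
    the point while the other exists at the point; hence the asymmetry between [dfx] and [dfy]. *)
Lemma differentiable_pt_lim_partial (f dfx : R -> R -> R) (x y dfy : R) :
  locally_2d (fun s t => is_derive (fun z => f z t) s (dfx s t)) x y ->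
  is_derive (fun z => f x z) y dfy -> continuity_2d_pt dfx x y ->
  differentiable_pt_lim f x y (dfx x y) dfy.
Proof.
  intros H1 H2 H3. apply filterdiff_differentiable_pt_lim.
  apply (is_derive_filterdiff f x y dfx dfy).
  - apply locally_2d_locally in H1. exact H1.
  - exact H2.
  - apply continuity_2d_pt_filterlim in H3. exact H3.
Qed.

Lemma locally_2d_forall (P : R -> R -> Prop) (x y : R) :
  (forall s t, P s t) -> locally_2d P x y.
Proof. intros H. exists (mkposreal 1 Rlt_0_1). intros; apply H. Qed.

Definition Cexp (z : C) : C := (exp (Re z) * cos (Im z), exp (Re z) * sin (Im z)).

Lemma continuity_2d_pt_fst_comp (f : R -> R) (x y : R) :
  continuous f x -> continuity_2d_pt (fun s _ => f s) x y.
Proof.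
  intros H. apply continuity_2d_pt_filterlim.
  apply (continuous_comp (fun z : R * R => fst z) f (x, y)); [apply continuous_fst|exact H].
Qed.

Lemma continuity_2d_pt_snd_comp (f : R -> R) (x y : R) :
  continuous f y -> continuity_2d_pt (fun _ t => f t) x y.
Proof.
  intros H. apply continuity_2d_pt_filterlim.
  apply (continuous_comp (fun z : R * R => snd z) f (x, y)); [apply continuous_snd|exact H].
Qed.

Lemma is_Cderive_Cexp (z : C) : is_Cderive Cexp z (Cexp z).
Proof.
  destruct z as [x y].
  apply (Cauchy_Riemann (fun x y => exp x * cos y) (fun x y => exp x * sin y)); simpl.
  - apply (differentiable_pt_lim_partial _ (fun x y => exp x * cos y)).
    + apply locally_2d_forall. intros s t. auto_derive; [exact I|ring].
    + auto_derive; [exact I|ring].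
    + apply continuity_2d_pt_mult;
        [apply continuity_2d_pt_fst_comp|apply continuity_2d_pt_snd_comp];
        apply (ex_derive_continuous (V := R_NormedModule)); auto_derive; exact I.
  - apply (differentiable_pt_lim_partial _ (fun x y => exp x * sin y)).
    + apply locally_2d_forall. intros s t. auto_derive; [exact I|ring].
    + auto_derive; [exact I|ring].
    + apply continuity_2d_pt_mult;
        [apply continuity_2d_pt_fst_comp|apply continuity_2d_pt_snd_comp];
        apply (ex_derive_continuous (V := R_NormedModule)); auto_derive; exact I.
Qed.

Lemma continuity_2d_pt_sqnorm (x y : R) : continuity_2d_pt (fun s t => s ^ 2 + t ^ 2) x y.
Proof.
  apply continuity_2d_pt_plus;
    [apply (continuity_2d_pt_fst_comp (fun s => s ^ 2))
    |apply (continuity_2d_pt_snd_comp (fun s => s ^ 2))];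
    apply (ex_derive_continuous (V := R_NormedModule) (fun s => s ^ 2)); auto_derive; exact I.
Qed.

Lemma locally_2d_fst_pos (x y : R) : 0 < x -> locally_2d (fun s _ => 0 < s) x y.
Proof.
  intros H. exists (mkposreal x H). simpl. intros s t Hs _.
  apply Rabs_def2 in Hs. lra.
Qed.

(** In the right half plane, where [1 - t] lies for [|t| < 1], the logarithm is locally
    [(ln (x ^ 2 + y ^ 2) / 2, atan (y / x))]. This form has neither a square root nor a case
    distinction, and its partial derivatives are computed directly. *)
Lemma is_Cderive_Clog (z : C) : 0 < Re z -> is_Cderive Clog z (/ z)%C.
Proof.
  destruct z as [x y]. intros Hx. unfold Re in Hx; simpl in Hx.
  assert (Hpos : forall s t : R, 0 < s -> 0 < s ^ 2 + t ^ 2).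
  { intros s t Hs. assert (0 < s ^ 2) by (apply pow_lt; exact Hs).
    generalize (pow2_ge_0 t). lra. }
  apply (is_derive_ext_loc (K := C_AbsRing) (V := C_NormedModule)
    (fun w : C => (ln (fst w ^ 2 + snd w ^ 2) / 2, atan (snd w / fst w)))).
  { exists (mkposreal x Hx). intros [s t] Hw. change (Cmod ((s, t) - (x, y)) < x) in Hw.
    assert (Hs := re_le_Cmod ((s, t) - (x, y))%C). unfold Re in Hs; simpl in Hs.
    assert (Hs' : 0 < s).
    { assert (Rabs (s + - x) < x) by lra. apply Rabs_def2 in H. lra. }
    unfold Clog, Carg, Cmod, Re, Im. simpl fst. simpl snd.
    destruct (Rlt_dec 0 s); [|lra]. f_equal.
    assert (Hq := sqrt_lt_R0 _ (Hpos s t Hs')).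
    rewrite <- (sqrt_sqrt (s ^ 2 + t ^ 2)) at 1 by (generalize (Hpos s t Hs'); lra).
    rewrite ln_mult by exact Hq. field. }
  apply (Cauchy_Riemann (fun x y => ln (x ^ 2 + y ^ 2) / 2) (fun x y => atan (y / x)));
    simpl fst; simpl snd.
  - apply (differentiable_pt_lim_partial _ (fun x y => x / (x ^ 2 + y ^ 2))).
    + apply (locally_2d_impl (fun s _ => 0 < s)); [|apply locally_2d_fst_pos; exact Hx].
      apply locally_2d_forall. intros s t Hs. specialize (Hpos s t Hs).
      auto_derive; [exact Hpos|]. field. lra.
    + specialize (Hpos x y Hx). auto_derive; [exact Hpos|]. field. nra.
    + apply continuity_2d_pt_mult; [apply continuity_2d_pt_id1|].
      apply continuity_2d_pt_inv; [apply continuity_2d_pt_sqnorm|].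
      specialize (Hpos x y Hx). lra.
  - apply (differentiable_pt_lim_partial _ (fun x y => - y / (x ^ 2 + y ^ 2))).
    + apply (locally_2d_impl (fun s _ => 0 < s)); [|apply locally_2d_fst_pos; exact Hx].
      apply locally_2d_forall. intros s t Hs. specialize (Hpos s t Hs).
      auto_derive; [lra|]. unfold Rsqr. field. split; [lra|]. nra.
    + specialize (Hpos x y Hx). auto_derive; [lra|]. unfold Rsqr. field. split; nra.
    + apply continuity_2d_pt_mult; [apply continuity_2d_pt_opp, continuity_2d_pt_id2|].
      apply continuity_2d_pt_inv; [apply continuity_2d_pt_sqnorm|].
      specialize (Hpos x y Hx). lra.
Qed.

(** A chain rule across two scalar fields, complex outside and real inside, proved by direct
    estimate. Dividing by [Cmod v + 1] covers the case [v = 0]. *)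
Lemma is_derive_line (g : C -> C) (p v l : C) (t0 : R) :
  is_Cderive g (p + RtoC t0 * v)%C l ->
  is_derive (K := R_AbsRing) (V := C_R_CompleteNormedModule)
    (fun t => g (p + RtoC t * v)%C) t0 (v * l)%C.
Proof.
  intros H. split; [apply is_linear_scal_l|].
  intros x Hx eps.
  rewrite <- (is_filter_lim_locally_unique (V := R_NormedModule) t0 x Hx). clear x Hx.
  assert (Hv : 0 < Cmod v + 1) by (generalize (Cmod_ge_0 v); lra).
  destruct (proj1 (is_CderiveP _ _ _) H (eps / (Cmod v + 1))) as [d [Hd Hw]].
  { apply Rdiv_lt_0_compat; [apply cond_pos|exact Hv]. }
  assert (Hdv : 0 < d / (Cmod v + 1)) by (apply Rdiv_lt_0_compat; assumption).
  exists (mkposreal _ Hdv). intros t Ht. change (Rabs (t - t0) < d / (Cmod v + 1)) in Ht.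
  change (norm (minus t t0)) with (Rabs (t - t0)).
  match goal with |- norm ?z <= _ =>
    replace z with (g (p + RtoC t * v) - g (p + RtoC t0 * v)
       - l * (p + RtoC t * v - (p + RtoC t0 * v)))%C end.
  2:{ apply injective_projections; simpl;
      unfold minus, plus, opp, scal; simpl; unfold mult; simpl; ring. }
  rewrite <- Cmod_norm.
  assert (E : Cmod (p + RtoC t * v - (p + RtoC t0 * v)) = Rabs (t - t0) * Cmod v).
  { replace (p + RtoC t * v - (p + RtoC t0 * v))%C with (RtoC (t - t0) * v)%C
      by (rewrite RtoC_minus; ring).
    rewrite Cmod_mult, Cmod_R. reflexivity. }
  assert (Hr := Rabs_pos (t - t0)). assert (Hcv := Cmod_ge_0 v).
  eapply Rle_trans; [apply Hw|]; rewrite E.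
  - apply (Rmult_lt_compat_r (Cmod v + 1)) in Ht; [|exact Hv].
    replace (d / (Cmod v + 1) * (Cmod v + 1)) with d in Ht by (field; lra). nra.
  - assert (He := cond_pos eps).
    replace (eps / (Cmod v + 1) * (Rabs (t - t0) * Cmod v))
      with (eps * Rabs (t - t0) * (Cmod v / (Cmod v + 1))) by (field; lra).
    rewrite <- (Rmult_1_r (eps * Rabs (t - t0))) at 2.
    apply Rmult_le_compat_l; [apply Rmult_le_pos; lra|].
    apply Rmult_le_reg_r with (Cmod v + 1); [exact Hv|]. unfold Rdiv.
    rewrite Rmult_assoc, Rinv_l; lra.
Qed.

(** The fundamental theorem of calculus on a segment. It serves both the bound on [Clog (1 - t)] and
    the vanishing of the mean of a derivative. *)
Lemma is_CInt_line (g dg : C -> C) (p v : C) (a b : R) :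
  a <= b ->
  (forall t, a <= t <= b -> is_Cderive g (p + RtoC t * v)%C (dg (p + RtoC t * v)%C)) ->
  (forall t, a <= t <= b -> Ccontinuous dg (p + RtoC t * v)%C) ->
  is_CInt (fun t => v * dg (p + RtoC t * v)%C)%C a b
    (g (p + RtoC b * v) - g (p + RtoC a * v))%C.
Proof.
  intros Hab Hg Hdg.
  apply (is_RInt_derive (V := C_R_CompleteNormedModule) (fun t => g (p + RtoC t * v)%C));
    intros t; rewrite Rmin_left, Rmax_right by lra; intros Ht.
  - apply is_derive_line. exact (Hg t Ht).
  - apply (continuous_comp (V := C_UniformSpace) (fun t => dg (p + RtoC t * v)%C)
      (fun w => (v * w)%C)).
    + apply (continuous_comp (V := C_UniformSpace) (fun t => (p + RtoC t * v)%C) dg).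
      * apply (ex_derive_continuous (V := C_R_NormedModule)).
        exists (v * RtoC 1)%C. apply (is_derive_line (fun w => w)). apply is_Cderive_id.
      * exact (Hdg t Ht).
    + eapply is_Cderive_continuous.
      apply is_Cderive_mult; [apply is_Cderive_const|apply is_Cderive_id].
Qed.

Lemma is_Cderive_opp (f : C -> C) (z l : C) :
  is_Cderive f z l -> is_Cderive (fun w => - f w)%C z (- l)%C.
Proof. exact (is_derive_opp (K := C_AbsRing) (V := C_NormedModule) f z l). Qed.

Lemma is_Cderive_pow (f : C -> C) (z l : C) (n : nat) :
  is_Cderive f z l ->
  is_Cderive (fun w => Cpow (f w) (S n)) z (RtoC (INR (S n)) * Cpow (f z) n * l)%C.
Proof.
  intros H. induction n as [|n IH].
  - eapply is_Cderive_eq; [exact (is_Cderive_mult _ _ _ _ _ H (is_Cderive_const (RtoC 1) z))|].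
    simpl. ring.
  - eapply is_Cderive_eq; [exact (is_Cderive_mult _ _ _ _ _ H IH)|].
    rewrite (S_INR (S n)), RtoC_plus. simpl Cpow. ring.
Qed.

Lemma is_Cderive_Cinv (z : C) :
  z <> RtoC 0 -> is_Cderive (fun w => / w)%C z (- / (z * z))%C.
Proof.
  intros Hz. apply is_CderiveP. intros eps Heps.
  assert (Hm := proj1 (Cmod_gt_0 z) Hz).
  set (m := Cmod z) in *.
  (* The remainder equals [(w - z) ^ 2 / (z ^ 2 * w)]. The first radius ensures [|w| > m / 2], and
     then the second makes [|w - z| / (m ^ 2 * |w|)] at most [eps]. *)
  exists (Rmin (m / 2) (eps * m ^ 3 / 2)). split.
  { apply Rmin_glb_lt; [lra|]. assert (0 < m ^ 3) by (apply pow_lt; exact Hm). nra. }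
  intros w Hw.
  assert (H1 := Rmin_l (m / 2) (eps * m ^ 3 / 2)).
  assert (H2 := Rmin_r (m / 2) (eps * m ^ 3 / 2)).
  assert (Hwm : m / 2 < Cmod w).
  { assert (H := Cmod_triangle w (z - w)). replace (w + (z - w))%C with z in H by ring.
    replace (z - w)%C with (- (w - z))%C in H by ring. rewrite Cmod_opp in H. fold m in H. lra. }
  assert (Hw0 : w <> RtoC 0) by (apply Cmod_gt_0; lra).
  replace (/ w - / z - - / (z * z) * (w - z))%C
    with ((w - z) * ((w - z) * / (z * z * w)))%C by (field; split; assumption).
  assert (Hzzw : (z * z * w)%C <> RtoC 0) by (repeat apply Cmult_neq_0; assumption).
  rewrite Cmod_mult, (Cmod_mult (w - z) (/ _)), Cmod_inv, !Cmod_mult by exact Hzzw.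
  rewrite Rmult_comm. apply Rmult_le_compat_r; [apply Cmod_ge_0|]. fold m.
  assert (Hd : 0 < m * m * Cmod w) by (repeat apply Rmult_lt_0_compat; lra).
  apply Rmult_le_reg_r with (m * m * Cmod w); [exact Hd|].
  rewrite Rmult_assoc, Rinv_l by lra. rewrite Rmult_1_r.
  assert (m * m * (m / 2) <= m * m * Cmod w) by (apply Rmult_le_compat_l; nra).
  assert (eps * (m * m * (m / 2)) <= eps * (m * m * Cmod w)) by (apply Rmult_le_compat_l; lra).
  replace (eps * (m * m * (m / 2))) with (eps * m ^ 3 / 2) in H0 by field. lra.
Qed.

Lemma Cmod_Cexp (w : C) : Cmod (Cexp w) = exp (Re w).
Proof.
  unfold Cmod, Cexp. simpl fst. simpl snd.
  replace ((exp (Re w) * cos (Im w)) ^ 2 + (exp (Re w) * sin (Im w)) ^ 2)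
    with (exp (Re w) ^ 2 * (Rsqr (sin (Im w)) + Rsqr (cos (Im w)))) by (unfold Rsqr; ring).
  rewrite sin2_cos2, Rmult_1_r. apply sqrt_pow2. left; apply exp_pos.
Qed.

Lemma Cexp_opp_r (w : C) : (Cexp w * Cexp (- w))%C = RtoC 1.
Proof.
  assert (H : exp (Re w) * exp (- Re w) = 1) by (rewrite <- exp_plus, Rplus_opp_r; apply exp_0).
  unfold Cexp, Re, Im in *. apply injective_projections; simpl;
    rewrite cos_neg, sin_neg.
  - transitivity ((exp (fst w) * exp (- fst w)) * (Rsqr (sin (snd w)) + Rsqr (cos (snd w)))).
    + unfold Rsqr; ring.
    + rewrite sin2_cos2, H. ring.
  - ring.
Qed.

Lemma Cexp_period (x : R) : Cexp (x, 2 * PI) = Cexp (x, 0).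
Proof.
  unfold Cexp. simpl. rewrite cos_2PI, sin_2PI, cos_0, sin_0. reflexivity.
Qed.

Lemma Cexp_opp_period (x : R) : Cexp (- (x, 2 * PI)) = Cexp (- (x, 0)).
Proof.
  unfold Cexp. simpl. rewrite cos_neg, sin_neg, cos_2PI, sin_2PI, Ropp_0, cos_0, sin_0.
  apply injective_projections; simpl; ring.
Qed.

Lemma is_Cderive_Cexp_opp_pow (w : C) (n : nat) :
  is_Cderive (fun w => Cpow (Cexp (- w)) n) w (- RtoC (INR n) * Cpow (Cexp (- w)) n)%C.
Proof.
  destruct n as [|n].
  - eapply is_Cderive_eq; [exact (is_Cderive_const (RtoC 1) w)|]. simpl. ring.
  - eapply is_Cderive_eq.
    + apply is_Cderive_pow. apply is_Cderive_comp; [apply is_Cderive_Cexp|].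
      apply is_Cderive_opp, is_Cderive_id.
    + simpl Cpow. ring.
Qed.

Lemma Re_one_minus_pos (t : C) : Cmod t < 1 -> 0 < Re (1 - t)%C.
Proof.
  intros H. assert (H1 := re_le_Cmod t). unfold Re in *. simpl.
  assert (H2 : Rabs (fst t) < 1) by lra. apply Rabs_def2 in H2. lra.
Qed.

Lemma Re_pos_neq_0 (z : C) : 0 < Re z -> z <> RtoC 0.
Proof. intros H ->. unfold Re in H. simpl in H. lra. Qed.

Lemma is_RInt_minus_ln (r : R) : 0 <= r < 1 ->
  is_RInt (fun s => r / (1 - s * r)) 0 1 (- ln (1 - r)).
Proof.
  intros Hr.
  replace (- ln (1 - r)) with (minus (- ln (1 - 1 * r)) (- ln (1 - 0 * r))).
  2:{ unfold minus, plus, opp; simpl. rewrite Rmult_0_l, Rminus_0_r, ln_1, Rmult_1_l. ring. }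
  apply (is_RInt_derive (fun s => - ln (1 - s * r)) (fun s => r / (1 - s * r)));
    intros s; rewrite Rmin_left, Rmax_right by lra; intros Hs; assert (0 < 1 - s * r) by nra.
  - auto_derive; [lra|]. field. lra.
  - apply (ex_derive_continuous (V := R_NormedModule) (fun s => r / (1 - s * r))).
    auto_derive. lra.
Qed.

(* Integrate the derivative of [s |-> Clog (1 - s t)] over [0, 1]. *)
Lemma Cmod_Clog_one_minus (t : C) : Cmod t < 1 ->
  Cmod (Clog (1 - t)) <= - ln (1 - Cmod t).
Proof.
  intros Ht.
  assert (Hst : forall s, 0 <= s <= 1 -> Cmod (RtoC s * t) <= s * Cmod t).
  { intros s Hs. rewrite Cmod_mult, Cmod_R, Rabs_right by lra. lra. }
  assert (Ht0 := Cmod_ge_0 t).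
  assert (Hpos : forall s, 0 <= s <= 1 -> 0 < Re (1 + RtoC s * - t)%C).
  { intros s Hs. replace (1 + RtoC s * - t)%C with (1 - RtoC s * t)%C by ring.
    apply Re_one_minus_pos. specialize (Hst s Hs). nra. }
  assert (H : is_CInt (fun s => - t * / (1 + RtoC s * - t))%C 0 1
    (Clog (1 + RtoC 1 * - t) - Clog (1 + RtoC 0 * - t))%C).
  { apply (is_CInt_line Clog (fun z => / z)%C); [lra| |].
    - intros s Hs. apply is_Cderive_Clog. exact (Hpos s Hs).
    - intros s Hs. eapply is_Cderive_continuous. apply is_Cderive_Cinv.
      apply Re_pos_neq_0. exact (Hpos s Hs). }
  replace (1 + RtoC 1 * - t)%C with (1 - t)%C in H by ring.
  replace (1 + RtoC 0 * - t)%C with (RtoC 1) in H by ring.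
  assert (H1 : Clog (RtoC 1) = RtoC 0).
  { unfold Clog, Carg, Re, Im. rewrite Cmod_1, ln_1. simpl.
    destruct (Rlt_dec 0 1); [|lra]. unfold Rdiv. rewrite Rmult_0_l, atan_0. reflexivity. }
  rewrite H1 in H.
  replace (Clog (1 - t) - RtoC 0)%C with (Clog (1 - t)) in H by ring.
  rewrite Cmod_norm.
  apply (norm_RInt_le (V := C_R_NormedModule) (fun s => - t * / (1 + RtoC s * - t))%C
    (fun s => Cmod t / (1 - s * Cmod t)) 0 1); [lra| |exact H|apply is_RInt_minus_ln; lra].
  intros s Hs. rewrite <- Cmod_norm.
  assert (Hne := Re_pos_neq_0 _ (Hpos s Hs)).
  rewrite Cmod_mult, Cmod_opp, Cmod_inv by exact Hne.
  apply Rmult_le_compat_l; [exact Ht0|]. apply Rinv_le_contravar; [nra|].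
  assert (H2 := Cmod_triangle (1 + RtoC s * - t) (RtoC s * t)).
  replace (1 + RtoC s * - t + RtoC s * t)%C with (RtoC 1) in H2 by ring.
  rewrite Cmod_1 in H2. specialize (Hst s Hs). lra.
Qed.

(** * Unsigned Stirling numbers *)

Module Stirling.
From mathcomp Require Import all_boot all_algebra ssrZ.
Import GRing.Theory.

Lemma stirling1_int_0 (k : nat) : stirling1_int 0 k = ((k == 0)%N%:R)%R.
Proof. by rewrite /stirling1_int big_ord0 coef1. Qed.

(** This recurrence and the next come from splitting off the last factor [X - n] of the falling
    factorial. *)
Lemma stirling1_int_S_0 (n : nat) :
  stirling1_int (S n) 0 = (- (stirling1_int n 0 * n%:R))%R.
Proof.
by rewrite /stirling1_int big_ord_recr /= mulrBr coefB coefMX coefMC sub0r.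
Qed.

Lemma stirling1_int_S_S (n k : nat) :
  stirling1_int (S n) (S k) = (stirling1_int n k - stirling1_int n (S k) * n%:R)%R.
Proof. by rewrite /stirling1_int big_ord_recr /= mulrBr coefB coefMX coefMC. Qed.

(** [Z_of_int] is a ring morphism, so opposite, sum and product pass to the reals through it. *)
Lemma int_to_ZE (x : int) : int_to_Z x = Z_of_int x.
Proof. by case: x => n //=; rewrite /Z_of_int; Lia.lia. Qed.

Lemma IZR_int_to_Z_opp (x : int) : IZR (int_to_Z (- x)%R) = - IZR (int_to_Z x).
Proof. by rewrite !int_to_ZE (rmorphN Z_of_int) opp_IZR. Qed.

Lemma IZR_int_to_Z_add (x y : int) :
  IZR (int_to_Z (x + y)%R) = IZR (int_to_Z x) + IZR (int_to_Z y).
Proof. by rewrite !int_to_ZE (rmorphD Z_of_int) plus_IZR. Qed.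

Lemma IZR_int_to_Z_muln (x : int) (n : nat) :
  IZR (int_to_Z (x * n%:R)%R) = IZR (int_to_Z x) * INR n.
Proof.
rewrite !int_to_ZE (rmorphM Z_of_int) mult_IZR.
by rewrite natz /= INR_IZR_INZ.
Qed.

End Stirling.
Import Stirling.

(** The coefficients of the rising factorial [x (x + 1) ... (x + n - 1)]. The sign is written with
    [n + k], of the same parity as [n - k], to avoid truncated subtraction. *)
Definition ustirling1 (n k : nat) : R := (-1) ^ (n + k) * stirling1 n k.

Lemma ustirling1_0_0 : ustirling1 0 0 = 1.
Proof. unfold ustirling1, stirling1. rewrite stirling1_int_0. simpl. ring. Qed.

Lemma ustirling1_0_S (k : nat) : ustirling1 0 (S k) = 0.
Proof. unfold ustirling1, stirling1. rewrite stirling1_int_0. simpl. ring. Qed.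

Lemma ustirling1_S_0 (n : nat) : ustirling1 (S n) 0 = INR n * ustirling1 n 0.
Proof.
  unfold ustirling1, stirling1. rewrite stirling1_int_S_0.
  rewrite IZR_int_to_Z_opp, IZR_int_to_Z_muln. simpl. ring.
Qed.

Lemma ustirling1_S_S (n k : nat) :
  ustirling1 (S n) (S k) = ustirling1 n k + INR n * ustirling1 n (S k).
Proof.
  unfold ustirling1, stirling1. rewrite stirling1_int_S_S.
  rewrite IZR_int_to_Z_add, IZR_int_to_Z_opp, IZR_int_to_Z_muln.
  rewrite !Nat.add_succ_r. simpl. ring.
Qed.

(** * Means over a period *)

(* In the coordinate [w] with [t = Cexp w], functions on the punctured unit disc become
   [2 PI i]-periodic functions on the left half plane; only the values on the two
   boundary lines of one period strip matter. *)
Definition strip_holo (g : C -> C) : Prop :=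
  (forall w, Re w < 0 -> C_holo_at g w) /\ (forall x, g (x, 2 * PI) = g (x, 0)).

Lemma strip_holo_const (c : C) : strip_holo (fun _ => c).
Proof.
  split; [|reflexivity]. intros w _. exists (RtoC 0). apply is_Cderive_const.
Qed.

Lemma strip_holo_plus (f g : C -> C) :
  strip_holo f -> strip_holo g -> strip_holo (fun w => f w + g w)%C.
Proof.
  intros [Hf Pf] [Hg Pg]. split.
  - intros w Hw. destruct (Hf w Hw) as [l Hl]. destruct (Hg w Hw) as [l' Hl'].
    eexists. exact (is_Cderive_plus _ _ _ _ _ Hl Hl').
  - intros x. now rewrite Pf, Pg.
Qed.

Lemma strip_holo_mult (f g : C -> C) :
  strip_holo f -> strip_holo g -> strip_holo (fun w => f w * g w)%C.
Proof.
  intros [Hf Pf] [Hg Pg]. split.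
  - intros w Hw. destruct (Hf w Hw) as [l Hl]. destruct (Hg w Hw) as [l' Hl'].
    eexists. exact (is_Cderive_mult _ _ _ _ _ Hl Hl').
  - intros x. now rewrite Pf, Pg.
Qed.

Lemma strip_holo_pow (f : C -> C) (n : nat) :
  strip_holo f -> strip_holo (fun w => Cpow (f w) n).
Proof.
  intros Hf. induction n as [|n IH]; [exact (strip_holo_const (RtoC 1))|].
  exact (strip_holo_mult _ _ Hf IH).
Qed.

Lemma strip_holo_comp (F g : C -> C) :
  strip_holo g -> (forall w, Re w < 0 -> C_holo_at F (g w)) ->
  strip_holo (fun w => F (g w)).
Proof.
  intros [Hg Pg] HF. split.
  - intros w Hw. destruct (Hg w Hw) as [l Hl]. destruct (HF w Hw) as [l' Hl'].
    eexists. exact (is_Cderive_comp _ _ _ _ _ Hl' Hl).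
  - intros x. now rewrite Pg.
Qed.

Lemma strip_holo_sum (f : nat -> C -> C) (n : nat) :
  (forall m, strip_holo (f m)) ->
  strip_holo (fun w => sum_n (G := C_AbelianMonoid) (fun m => f m w) n).
Proof.
  intros Hf. split.
  - induction n as [|n IH]; intros w Hw.
    + destruct (proj1 (Hf O) w Hw) as [l Hl]. exists l.
      apply (is_derive_ext (K := C_AbsRing) (V := C_NormedModule) (f O)); [|exact Hl].
      intros z. rewrite sum_O. reflexivity.
    + destruct (IH w Hw) as [l Hl]. destruct (proj1 (Hf (S n)) w Hw) as [l' Hl'].
      exists (l + l')%C.
      eapply (is_derive_ext (K := C_AbsRing) (V := C_NormedModule));
        [|exact (is_Cderive_plus _ _ _ _ _ Hl Hl')].
      intros z. rewrite sum_Sn. reflexivity.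
  - intros x. apply sum_n_ext. intros m. apply (Hf m).
Qed.

Lemma strip_holo_Cexp_opp_pow (n : nat) : strip_holo (fun w => Cpow (Cexp (- w)) n).
Proof.
  split.
  - intros w _. eexists. apply is_Cderive_Cexp_opp_pow.
  - intros x. now rewrite Cexp_opp_period.
Qed.

(* Not divided by [2 PI]. *)
Definition cmean (g : C -> C) (x : R) : C := vint g x 0 (2 * PI).

Lemma is_cmean (g : C -> C) (x : R) :
  strip_holo g -> x < 0 -> is_CInt (fun y => g (x, y)) 0 (2 * PI) (cmean g x).
Proof.
  intros [Hg _] Hx. apply (RInt_correct (V := C_R_CompleteNormedModule)).
  apply ex_RInt_continuous. intros y _. apply continuous_vertical.
  destruct (Hg (x, y) Hx) as [l Hl]. exact (is_Cderive_continuous g _ l Hl).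
Qed.

Lemma cmean_unique (g : C -> C) (x : R) (l : C) :
  is_CInt (fun y => g (x, y)) 0 (2 * PI) l -> cmean g x = l.
Proof. exact (is_RInt_unique (V := C_R_CompleteNormedModule) _ _ _ l). Qed.

Lemma cmean_plus (f g : C -> C) (x : R) :
  strip_holo f -> strip_holo g -> x < 0 ->
  cmean (fun w => f w + g w)%C x = (cmean f x + cmean g x)%C.
Proof.
  intros Hf Hg Hx. apply cmean_unique.
  exact (is_CInt_plus _ _ _ _ _ _ (is_cmean f x Hf Hx) (is_cmean g x Hg Hx)).
Qed.

Lemma cmean_Cmult (g : C -> C) (c : C) (x : R) :
  strip_holo g -> x < 0 -> cmean (fun w => c * g w)%C x = (c * cmean g x)%C.
Proof.
  intros Hg Hx. apply cmean_unique.
  exact (is_CInt_Cmult _ _ _ c _ (is_cmean g x Hg Hx)).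
Qed.

Lemma cmean_sum (f : nat -> C -> C) (n : nat) (x : R) :
  (forall m, strip_holo (f m)) -> x < 0 ->
  cmean (fun w => sum_n (G := C_AbelianMonoid) (fun m => f m w) n) x =
  sum_n (G := C_AbelianMonoid) (fun m => cmean (f m) x) n.
Proof.
  intros Hf Hx. apply cmean_unique. induction n as [|n IH].
  - rewrite sum_O. eapply is_RInt_ext; [|exact (is_cmean _ x (Hf O) Hx)].
    intros y _. simpl. rewrite sum_O. reflexivity.
  - rewrite sum_Sn. eapply is_RInt_ext;
      [|exact (is_CInt_plus _ _ _ _ _ _ IH (is_cmean _ x (Hf (S n)) Hx))].
    intros y _. simpl. rewrite sum_Sn. reflexivity.
Qed.

Lemma cmean_bound (g : C -> C) (x M : R) :
  strip_holo g -> x < 0 -> (forall y, Cmod (g (x, y)) <= M) ->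
  Cmod (cmean g x) <= 2 * PI * M.
Proof.
  intros Hg Hx HM. assert (Hpi := PI_RGT_0).
  replace (2 * PI) with (2 * PI - 0) by ring.
  apply (is_CInt_bound (fun y => g (x, y))); [lra|intros y _; apply HM|].
  exact (is_cmean g x Hg Hx).
Qed.

(* In the contour integral over a period rectangle the horizontal sides cancel. *)
Lemma cmean_const (g : C -> C) (x1 x2 : R) :
  strip_holo g -> x1 <= x2 -> x2 < 0 -> cmean g x1 = cmean g x2.
Proof.
  intros [Hg Pg] H12 H2. assert (Hpi := PI_RGT_0).
  assert (H : rect g x1 x2 0 (2 * PI) = RtoC 0).
  { apply goursat; [exact H12|lra|]. intros x y Hx _. apply Hg. unfold Re; simpl; lra. }
  unfold rect in H.
  replace (hint g (2 * PI) x1 x2) with (hint g 0 x1 x2) in H.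
  2:{ unfold hint. apply (RInt_ext (V := C_R_CompleteNormedModule)). intros x _. now rewrite Pg. }
  fold (cmean g x1) (cmean g x2) in H.
  assert (HCi : (Ci * Ci)%C = (- RtoC 1)%C) by (apply injective_projections; simpl; ring).
  assert (E : (cmean g x1 - cmean g x2 = Ci *
     (hint g 0 x1 x2 + Ci * cmean g x2 - hint g 0 x1 x2 - Ci * cmean g x1))%C).
  { transitivity (Ci * Ci * (cmean g x2 - cmean g x1))%C; [rewrite HCi|]; ring. }
  rewrite H in E.
  replace (cmean g x1) with ((cmean g x1 - cmean g x2) + cmean g x2)%C by ring.
  rewrite E. ring.
Qed.

Lemma exp_le (x y : R) : x <= y -> exp x <= exp y.
Proof.
  intros [H|H]; [left; apply exp_increasing; exact H|rewrite H; right; reflexivity].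
Qed.

(** The hypothesis says [O (|t|)] near [t = 0]. The mean is the same on every circle and at most
    [2 * PI * K] times the radius, so it is zero. *)
Lemma cmean_decay (g : C -> C) (K x0 x : R) :
  strip_holo g -> (forall w, Re w <= x0 -> Cmod (g w) <= K * exp (Re w)) ->
  x < 0 -> cmean g x = RtoC 0.
Proof.
  intros Hg HK Hx. apply Cmod_eq_0.
  destruct (Rle_lt_or_eq_dec _ _ (Cmod_ge_0 (cmean g x))) as [Hp|Hp]; [exfalso|now rewrite <- Hp].
  assert (Hpi := PI_RGT_0).
  set (m := Cmod (cmean g x)) in *.
  set (D := 2 * PI * (Rabs K + 1)).
  assert (HD : 0 < D) by (unfold D; generalize (Rabs_pos K); nra).
  assert (HmD : 0 < m / (2 * D)) by (apply Rdiv_lt_0_compat; lra).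
  (* Three demands on [x']: to be left of [x] so that the means agree, left of [x0] so that the
     bound holds, and far enough left that the mean is at most [m / 2]. *)
  set (x' := Rmin x (Rmin x0 (ln (m / (2 * D))))).
  assert (H1 : x' <= x) by apply Rmin_l.
  assert (H2 : x' <= x0) by (eapply Rle_trans; [apply Rmin_r|apply Rmin_l]).
  assert (H3 : x' <= ln (m / (2 * D))) by (eapply Rle_trans; [apply Rmin_r|apply Rmin_r]).
  assert (H4 : exp x' <= m / (2 * D)).
  { rewrite <- (exp_ln (m / (2 * D)) HmD). apply exp_le. exact H3. }
  assert (Hb : m <= 2 * PI * (K * exp x')).
  { unfold m. rewrite <- (cmean_const g x' x Hg H1 Hx).
    apply cmean_bound; [exact Hg|lra|]. intros y. apply (HK (x', y)). exact H2. }
  assert (Hk := Rle_abs K). assert (He := exp_pos x').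
  assert (Hc : 2 * PI * (K * exp x') <= D * exp x') 
    by (unfold D; rewrite (Rmult_assoc (2 * PI)); apply Rmult_le_compat_l; [lra|];
        apply Rmult_le_compat_r; lra).
  assert (Hd : D * exp x' <= D * (m / (2 * D))) by (apply Rmult_le_compat_l; lra).
  replace (D * (m / (2 * D))) with (m / 2) in Hd by (field; lra). lra.
Qed.

(** Along the vertical segment the integral of [Ci * dg] is the increment of [g] over one period,
    which is zero; multiplying by [- Ci] removes the [Ci] of [dz = i dy]. *)
Lemma cmean_derive (g dg : C -> C) (x : R) :
  (forall w, Re w < 0 -> is_Cderive g w (dg w)) -> strip_holo dg ->
  g (x, 2 * PI) = g (x, 0) -> x < 0 -> cmean dg x = RtoC 0.
Proof.
  intros Hg Hdg Pg Hx. assert (Hpi := PI_RGT_0).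
  assert (El : forall t, ((x, 0) + RtoC t * Ci)%C = (x, t)).
  { intros t. apply injective_projections; simpl; ring. }
  assert (H := is_CInt_line g dg (x, 0) Ci 0 (2 * PI) ltac:(lra)).
  rewrite !El, Pg in H.
  assert (H' : is_CInt (fun y => Ci * dg (x, y))%C 0 (2 * PI) (RtoC 0)).
  { replace (RtoC 0) with (g (x, 0) - g (x, 0))%C by ring.
    eapply is_RInt_ext; [|apply H].
    - intros t _. simpl. now rewrite El.
    - intros t _. rewrite El. apply Hg. exact Hx.
    - intros t _. rewrite El. destruct (proj1 Hdg (x, t) Hx) as [l Hl].
      exact (is_Cderive_continuous dg _ l Hl). }
  apply cmean_unique.
  replace (RtoC 0) with (- Ci * RtoC 0)%C by ring.
  eapply is_RInt_ext; [|exact (is_CInt_Cmult _ _ _ (- Ci)%C _ H')].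
  intros y _. apply injective_projections; simpl; ring.
Qed.

(** * The logarithm in the coordinate [w], and Stirling numbers as means of its powers *)

Definition CL (w : C) : C := (- Clog (1 - Cexp w))%C.

Lemma Cmod_Cexp_lt_1 (w : C) : Re w < 0 -> Cmod (Cexp w) < 1.
Proof. intros H. rewrite Cmod_Cexp, <- exp_0. apply exp_increasing. exact H. Qed.

Lemma is_Cderive_CL (w : C) : Re w < 0 -> is_Cderive CL w (Cexp w / (1 - Cexp w))%C.
Proof.
  intros Hw. assert (Hp := Re_one_minus_pos _ (Cmod_Cexp_lt_1 w Hw)).
  eapply is_Cderive_eq.
  - apply is_Cderive_opp. apply (is_Cderive_comp Clog (fun w => 1 - Cexp w)%C).
    + apply is_Cderive_Clog. exact Hp.
    + apply is_Cderive_plus; [apply is_Cderive_const|]. apply is_Cderive_opp, is_Cderive_Cexp.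
  - field. apply Re_pos_neq_0. exact Hp.
Qed.

Lemma strip_holo_CL : strip_holo CL.
Proof.
  split.
  - intros w Hw. eexists. exact (is_Cderive_CL w Hw).
  - intros x. unfold CL. now rewrite Cexp_period.
Qed.

Lemma Cmod_CL (w : C) : Re w < 0 -> Cmod (CL w) <= - ln (1 - exp (Re w)).
Proof.
  intros Hw. unfold CL. rewrite Cmod_opp, <- Cmod_Cexp.
  apply Cmod_Clog_one_minus. exact (Cmod_Cexp_lt_1 w Hw).
Qed.

(** The threshold [- 1] gives [r = exp (Re w) <= / 2], hence [(1 - r) * (1 + 2 * r) >= 1] and [exp
    (- (2 * r)) <= / (1 + 2 * r) <= 1 - r]. It shows that [CL] vanishes to first order at
    [t = 0]. *)
Lemma Cmod_CL_linear (w : C) : Re w <= - 1 -> Cmod (CL w) <= 2 * exp (Re w).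
Proof.
  intros Hw. eapply Rle_trans; [apply Cmod_CL; lra|].
  assert (Hr : exp (Re w) <= / 2).
  { assert (exp (Re w) <= exp (Ropp 1)).
    { apply exp_le. lra. }
    assert (H1 := exp_ineq1_le 1). rewrite exp_Ropp in H.
    assert (/ exp 1 <= / 2) by (apply Rinv_le_contravar; lra). lra. }
  assert (Hr0 := exp_pos (Re w)). set (r := exp (Re w)) in *.
  assert (H : ln (exp (- (2 * r))) <= ln (1 - r)).
  { apply ln_le; [apply exp_pos|]. rewrite exp_Ropp.
    assert (H1 := exp_ineq1_le (2 * r)).
    apply Rle_trans with (/ (1 + 2 * r)); [apply Rinv_le_contravar; lra|].
    apply Rmult_le_reg_r with (1 + 2 * r); [lra|]. rewrite Rinv_l by lra. nra. }
  rewrite ln_exp in H. lra.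
Qed.

Definition CLpow (m : nat) (w : C) : C := (Cpow (CL w) m / RtoC (INR (fact m)))%C.

Lemma RtoC_INR_fact_neq_0 (m : nat) : RtoC (INR (fact m)) <> RtoC 0.
Proof. intros H. apply RtoC_inj in H. exact (INR_fact_neq_0 m H). Qed.

Lemma strip_holo_CLpow (m : nat) : strip_holo (CLpow m).
Proof.
  apply (strip_holo_mult (fun w => Cpow (CL w) m) (fun _ => / RtoC (INR (fact m)))%C);
    [apply strip_holo_pow, strip_holo_CL|apply strip_holo_const].
Qed.

(** The derivative of [L ^ m / m!] with respect to [L]; the value 0 at [m = 0] lets one formula
    cover all [m]. *)
Definition CLpow_pred (m : nat) (w : C) : C :=
  match m with O => RtoC 0 | S k => CLpow k w end.

Lemma is_Cderive_CLpow (m : nat) (w : C) :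
  Re w < 0 -> is_Cderive (CLpow m) w (CLpow_pred m w * (Cexp w / (1 - Cexp w)))%C.
Proof.
  intros Hw. destruct m as [|m].
  - eapply is_Cderive_eq; [exact (is_Cderive_const (CLpow O w) w)|]. simpl. ring.
  - eapply is_Cderive_eq.
    + apply (is_Cderive_mult (fun w => Cpow (CL w) (S m)) (fun _ => / RtoC (INR (fact (S m))))%C);
        [apply is_Cderive_pow, is_Cderive_CL, Hw|apply is_Cderive_const].
    + unfold CLpow_pred, CLpow.
      assert (Hf := RtoC_INR_fact_neq_0 m).
      assert (HS : RtoC (INR (S m)) <> RtoC 0).
      { intros H. apply RtoC_inj in H. exact (not_0_INR (S m) (Nat.neq_succ_0 m) H). }
      rewrite fact_simpl, mult_INR, RtoC_mult. 
      field. repeat split; try assumption.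
      apply Re_pos_neq_0, Re_one_minus_pos, Cmod_Cexp_lt_1, Hw.
Qed.

(* The derivative of [CLpow m w * (1 - Cexp w) * Cexp (- w) ^ (n + 1)] has mean zero;
   expanding it gives the recurrence of the Stirling numbers. *)
Lemma cmean_CLpow_rec (m n : nat) (x : R) : x < 0 ->
  (RtoC (INR (S n)) * cmean (fun w => CLpow m w * Cpow (Cexp (- w)) (S n)) x =
   cmean (fun w => CLpow_pred m w * Cpow (Cexp (- w)) n) x +
   RtoC (INR n) * cmean (fun w => CLpow m w * Cpow (Cexp (- w)) n) x)%C.
Proof.
  intros Hx.
  assert (H0 : strip_holo (fun w => CLpow_pred m w * Cpow (Cexp (- w)) n)%C).
  { apply strip_holo_mult; [|apply strip_holo_Cexp_opp_pow].
    destruct m; [apply strip_holo_const|apply strip_holo_CLpow]. }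
  assert (Hk : forall k, strip_holo (fun w => CLpow m w * Cpow (Cexp (- w)) k)%C).
  { intros k. apply strip_holo_mult; [apply strip_holo_CLpow|apply strip_holo_Cexp_opp_pow]. }
  assert (Hc : forall k c, strip_holo (fun w => c * (CLpow m w * Cpow (Cexp (- w)) k))%C).
  { intros k c. exact (strip_holo_mult _ _ (strip_holo_const c) (Hk k)). }
  set (dG := fun w => (CLpow_pred m w * Cpow (Cexp (- w)) n +
     (RtoC (INR n) * (CLpow m w * Cpow (Cexp (- w)) n) +
      - RtoC (INR (S n)) * (CLpow m w * Cpow (Cexp (- w)) (S n))))%C).
  assert (HdG : strip_holo dG).
  { apply (strip_holo_plus _ _ H0). apply strip_holo_plus; apply Hc. }
  assert (HG : cmean dG x = RtoC 0).
  { apply (cmean_derive (fun w => CLpow m w * ((1 - Cexp w) * Cpow (Cexp (- w)) (S n)))%C);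
      [|exact HdG| |exact Hx].
    - intros w Hw. eapply is_Cderive_eq.
      + apply is_Cderive_mult; [apply is_Cderive_CLpow, Hw|].
        apply is_Cderive_mult; [|apply is_Cderive_Cexp_opp_pow].
        apply is_Cderive_plus; [apply is_Cderive_const|]. apply is_Cderive_opp, is_Cderive_Cexp.
      + unfold dG. assert (He := Cexp_opp_r w). rewrite Cpow_S, S_INR, RtoC_plus.
        set (E := Cexp w) in *. set (E' := Cexp (- w)) in *. set (En := Cpow E' n).
        set (P := CLpow_pred m w). set (Q := CLpow m w).
        assert (H1 : (1 - E)%C <> RtoC 0)
          by (apply Re_pos_neq_0, Re_one_minus_pos, Cmod_Cexp_lt_1, Hw).
        (* The factor [1 - E] has cancelled the denominator of the derivative of [CL]. Each
           remaining [E] is paired with an [E'], ready for [E * E' = 1]. *)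
        transitivity (P * (E * E') * En - Q * (E * E') * En
          - (RtoC (INR n) + 1) * Q * E' * En + (RtoC (INR n) + 1) * Q * (E * E') * En)%C.
        * field. exact H1.
        * rewrite He. ring.
    - rewrite (proj2 (strip_holo_CLpow m)), Cexp_period, Cexp_opp_period. reflexivity. }
  unfold dG in HG.
  rewrite cmean_plus in HG; [|exact H0|apply strip_holo_plus; apply Hc|exact Hx].
  rewrite cmean_plus in HG by (try apply Hc; exact Hx).
  rewrite !cmean_Cmult in HG by (try apply Hk; exact Hx).
  match type of HG with (?a + (?b + - ?c * ?d))%C = _ =>
    replace (c * d)%C with (c * d + (a + (b + - c * d)))%C by (rewrite HG; ring) end.
  ring.
Qed.

(** For [m = 0] the integrand is 1; for [m > 0] it is [O (|t|)] and [cmean_decay] applies. *)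
Lemma cmean_CLpow_0 (m : nat) (x : R) : x < 0 ->
  cmean (CLpow m) x = (RtoC (2 * PI) * RtoC (ustirling1 0 m))%C.
Proof.
  intros Hx. destruct m as [|m].
  - rewrite ustirling1_0_0. apply cmean_unique.
    replace (RtoC (2 * PI) * RtoC 1)%C
      with (RtoC 1 * RtoC (2 * PI - 0) + RtoC 0 * RtoC (((2 * PI) ^ 2 - 0 ^ 2) / 2))%C
      by (rewrite Rminus_0_r; ring).
    eapply is_RInt_ext; [|apply is_CInt_affine].
    intros y _. unfold CLpow. simpl. apply injective_projections; simpl; field.
  - rewrite ustirling1_0_S. replace (RtoC (2 * PI) * RtoC 0)%C with (RtoC 0) by ring.
    apply (cmean_decay _ (2 ^ S m) (-1)); [apply strip_holo_CLpow| |exact Hx].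
    intros w Hw. unfold CLpow.
    rewrite Cmod_div by apply RtoC_INR_fact_neq_0. rewrite Cmod_pow, Cmod_R.
    assert (Hf : 1 <= INR (fact (S m))) by (apply (le_INR 1); apply lt_O_fact).
    rewrite Rabs_right by lra.
    assert (H1 := Cmod_CL_linear w Hw). assert (H0 := Cmod_ge_0 (CL w)).
    assert (He := exp_pos (Re w)).
    assert (He1 : exp (Re w) <= 1).
    { rewrite <- exp_0. left. apply exp_increasing. lra. }
    assert (Hp : Cmod (CL w) ^ S m <= 2 ^ S m * exp (Re w)).
    { eapply Rle_trans; [apply pow_incr; split; [exact H0|exact H1]|].
      rewrite Rpow_mult_distr. apply Rmult_le_compat_l; [apply pow_le; lra|].
      simpl. rewrite <- (Rmult_1_r (exp (Re w))) at 3.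
      apply Rmult_le_compat_l; [lra|]. rewrite <- (pow1 m). apply pow_incr. lra. }
    apply Rmult_le_reg_r with (INR (fact (S m))); [lra|].
    unfold Rdiv. rewrite Rmult_assoc, Rinv_l, Rmult_1_r by lra.
    eapply Rle_trans; [exact Hp|].
    assert (0 <= 2 ^ S m * exp (Re w)) by (apply Rmult_le_pos; [apply pow_le|]; lra).
    nra.
Qed.

(** This is the generating function of the unsigned Stirling numbers, read one coefficient at a
    time. Both sides satisfy the same recurrence in [n]; the factor [n + 1] on the side of the means
    is absorbed by the factorial. *)
Lemma cmean_CLpow (n m : nat) (x : R) : x < 0 ->
  cmean (fun w => CLpow m w * Cpow (Cexp (- w)) n)%C x =
  (RtoC (2 * PI) * RtoC (ustirling1 n m / INR (fact n)))%C.
Proof.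
  intros Hx. revert m. induction n as [|n IH]; intros m.
  - transitivity (cmean (CLpow m) x).
    + apply cmean_unique. eapply is_RInt_ext; [|exact (is_cmean _ x (strip_holo_CLpow m) Hx)].
      intros y _. simpl. ring.
    + rewrite cmean_CLpow_0 by exact Hx. do 2 f_equal. simpl. field.
  - assert (H := cmean_CLpow_rec m n x Hx). rewrite IH in H.
    assert (HS : INR (S n) <> 0) by (apply not_0_INR; lia).
    assert (HSC : RtoC (INR (S n)) <> RtoC 0) by (intros E; apply RtoC_inj in E; exact (HS E)).
    assert (Hf := INR_fact_neq_0 n).
    match type of H with (_ * ?z)%C = _ =>
      replace z with (/ RtoC (INR (S n)) * (RtoC (INR (S n)) * z))%C by (field; exact HSC) end.
    rewrite H. rewrite fact_simpl, mult_INR.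
    destruct m as [|m].
    + replace (cmean _ x) with (RtoC 0).
      * rewrite ustirling1_S_0, <- RtoC_inv, <- !RtoC_mult, <- RtoC_plus, <- RtoC_mult by exact HS.
        f_equal. field. split; assumption.
      * symmetry. simpl. transitivity (cmean (fun w => RtoC 0 * RtoC 0)%C x).
        -- unfold cmean, vint. apply (RInt_ext (V := C_R_CompleteNormedModule)).
           intros y _. exact (eq_trans (Cmult_0_l _) (eq_sym (Cmult_0_l _))).
        -- rewrite cmean_Cmult by (try exact Hx; apply strip_holo_const). ring.
    + simpl CLpow_pred. rewrite IH.
      rewrite ustirling1_S_S, <- RtoC_inv, <- !RtoC_mult, <- RtoC_plus, <- RtoC_mult by exact HS.
      f_equal. field. split; assumption.
Qed.

(** * The Borel transform *)

(** The index shift leaves [(m + 1)! / m! = m + 1 <= 2 ^ m], whence the 2 in [q]; adding 1 to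
    [Rabs K] makes [q] positive. *)
Lemma gevrey1_borel_coef (a : nat -> C) :
  gevrey1 a -> exists D q, 0 <= D /\ 0 < q /\
    forall m, Cmod (a (S m)) / INR (fact m) <= D * q ^ m.
Proof.
  intros [Cst [K H]].
  assert (HC := Rabs_pos Cst). assert (HK := Rabs_pos K).
  exists (Rabs Cst * (Rabs K + 1)), (2 * (Rabs K + 1)).
  split; [apply Rmult_le_pos; lra|]. split; [lra|]. intros m.
  assert (Hf : 0 < INR (fact m)) by apply INR_fact_lt_0.
  apply Rmult_le_reg_r with (INR (fact m)); [exact Hf|].
  unfold Rdiv. rewrite Rmult_assoc, Rinv_l, Rmult_1_r by lra.
  eapply Rle_trans; [apply H|]. rewrite fact_simpl, mult_INR.
  assert (H2 : INR (S m) <= 2 ^ m).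
  { clear. induction m as [|m IH]; [simpl; lra|].
    rewrite S_INR. assert (1 <= 2 ^ m) by (apply pow_R1_Rle; lra). simpl pow. lra. }
  assert (H3 : Cst * K ^ S m <= Rabs Cst * (Rabs K + 1) ^ S m).
  { eapply Rle_trans; [apply Rle_abs|]. rewrite Rabs_mult, <- RPow_abs.
    apply Rmult_le_compat_l; [exact HC|]. apply pow_incr. lra. }
  assert (H4 : 0 <= INR (S m)) by apply pos_INR.
  assert (H5 : 0 <= Rabs Cst * (Rabs K + 1) ^ S m)
    by (apply Rmult_le_pos; [exact HC|apply pow_le; lra]).
  replace (Rabs Cst * (Rabs K + 1) * (2 * (Rabs K + 1)) ^ m * INR (fact m))
    with (Rabs Cst * (Rabs K + 1) ^ S m * (2 ^ m * INR (fact m)))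
    by (rewrite (Rpow_mult_distr 2); simpl pow; ring).
  eapply Rle_trans.
  - apply Rmult_le_compat_r; [|exact H3]. apply Rmult_le_pos; lra.
  - apply Rmult_le_compat_l; [exact H5|]. apply Rmult_le_compat_r; lra.
Qed.

Lemma series_tail_bound (f : nat -> C) (l : C) (D rho : R) (n : nat) :
  0 <= D -> 0 <= rho <= / 2 -> (forall m, Cmod (f m) <= D * rho ^ m) ->
  is_series (K := C_AbsRing) (V := C_NormedModule) f l ->
  Cmod (l - sum_n (G := C_AbelianMonoid) f n) <= 2 * D * rho ^ S n.
Proof.
  intros HD Hr Hf Hl.
  assert (Hp : 0 <= D * rho ^ S n) by (apply Rmult_le_pos; [exact HD|apply pow_le; lra]).
  (* Since [rho <= / 2], the next [k] terms are dominated by [D * rho ^ S n] times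
     [1 + / 2 + ... + (/ 2) ^ (k - 1)], which is [2 - 2 * (/ 2) ^ k]. *)
  assert (Hk : forall k,
     Cmod (sum_n (G := C_AbelianMonoid) f (n + k) - sum_n (G := C_AbelianMonoid) f n)
     <= D * rho ^ S n * (2 - 2 * (/ 2) ^ k)).
  { induction k as [|k IH].
    - rewrite Nat.add_0_r. match goal with |- Cmod ?z <= _ => replace z with (RtoC 0) by ring end.
      rewrite Cmod_0. simpl. lra.
    - rewrite Nat.add_succ_r, sum_Sn.
      change (plus (sum_n (G := C_AbelianMonoid) f (n + k)) (f (S (n + k))))
        with (sum_n (G := C_AbelianMonoid) f (n + k) + f (S (n + k)))%C.
      match goal with |- Cmod (?s + ?t - ?u) <= _ =>
        replace (s + t - u)%C with ((s - u) + t)%C by ring end.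
      eapply Rle_trans; [apply Cmod_triangle|].
      assert (H1 := Hf (S (n + k))).
      replace (S (n + k)) with (S n + k)%nat in H1 at 2 by lia. rewrite pow_add in H1.
      assert (H2 : rho ^ k <= (/ 2) ^ k) by (apply pow_incr; lra).
      assert (H3 := Rmult_le_compat_l _ _ _ Hp H2).
      simpl pow at 2. simpl pow in *. lra. }
  apply le_epsilon. intros eps Heps.
  assert (He : 0 < eps / 2) by lra.
  (* Passing from product balls to [Cmod] costs a factor [sqrt 2 <= 2], hence the radius
     [eps / 2]. *)
  assert (HB : locally (T := C_NormedModule) l (fun z => Cmod (z - l) < eps)).
  { exists (mkposreal _ He). intros z Hz.
    apply (C_NormedModule_mixin_compat2 l z (mkposreal _ He)) in Hz.
    change (Cmod (z - l) < sqrt 2 * (eps / 2)) in Hz.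
    assert (sqrt 2 <= 2).
    { rewrite <- (sqrt_pow2 2) at 2 by lra. apply sqrt_le_1_alt. lra. }
    nra. }
  destruct (Hl _ HB) as [N HN].
  specialize (HN (n + N)%nat ltac:(lia)). specialize (Hk N).
  set (s := sum_n (G := C_AbelianMonoid) f n) in *.
  change (Cmod (sum_n (G := C_AbelianMonoid) f (n + N) - l) < eps) in HN.
  set (t := sum_n (G := C_AbelianMonoid) f (n + N)) in *.
  replace (l - s)%C with ((t - s) + - (t - l))%C by ring.
  eapply Rle_trans; [apply Cmod_triangle|]. rewrite Cmod_opp.
  assert (0 < (/ 2) ^ N) by (apply pow_lt; lra).
  assert (D * rho ^ S n * (2 - 2 * (/ 2) ^ N) <= D * rho ^ S n * 2)
    by (apply Rmult_le_compat_l; lra).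
  lra.
Qed.

(** The radius [/ (2 * q)] brings the ratio [q * Cmod zeta] below [/ 2], as the geometric tail bound
    requires. *)
Lemma borel_tail_bound (a : nat -> C) (n : nat) :
  gevrey1 a -> exists M d, 0 <= M /\ 0 < d /\
    forall zeta l, Cmod zeta < d ->
      is_series (K := C_AbsRing) (V := C_NormedModule) (borel_term a zeta) l ->
      Cmod (l - sum_n (G := C_AbelianMonoid) (borel_term a zeta) n) <= M * Cmod zeta ^ S n.
Proof.
  intros H. destruct (gevrey1_borel_coef a H) as [D [q [HD [Hq Ha]]]].
  exists (2 * D * q ^ S n), (/ (2 * q)).
  split; [apply Rmult_le_pos; [lra|apply pow_le; lra]|].
  split; [apply Rinv_0_lt_compat; lra|]. intros zeta l Hz Hl.
  replace (2 * D * q ^ S n * Cmod zeta ^ S n) with (2 * D * (q * Cmod zeta) ^ S n)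
    by (rewrite Rpow_mult_distr; ring).
  assert (Hz0 := Cmod_ge_0 zeta).
  apply series_tail_bound; [exact HD| | |exact Hl].
  - split; [apply Rmult_le_pos; lra|].
    apply (Rmult_lt_compat_l q) in Hz; [|exact Hq].
    replace (q * / (2 * q)) with (/ 2) in Hz by (field; lra). lra.
  - intros m. unfold borel_term. rewrite Cmod_div by apply RtoC_INR_fact_neq_0.
    rewrite Cmod_mult, Cmod_pow, Cmod_R, Rabs_right by (apply Rle_ge, pos_INR).
    rewrite Rpow_mult_distr, <- Rmult_assoc.
    replace (Cmod (a (S m)) * Cmod zeta ^ m / INR (fact m))
      with (Cmod (a (S m)) / INR (fact m) * Cmod zeta ^ m) by (field; apply INR_fact_neq_0).
    apply Rmult_le_compat_r; [apply pow_le; exact Hz0|apply Ha].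
Qed.

Lemma Delta_lam_CL (lam : R) (w : C) : Re w < 0 -> Delta_lam lam (RtoC lam * CL w)%C.
Proof.
  intros Hw. exists (CL w). split; [|reflexivity]. exists (1 - Cexp w)%C. split; [|reflexivity].
  replace (1 - Cexp w - 1)%C with (- Cexp w)%C by ring. rewrite Cmod_opp.
  exact (Cmod_Cexp_lt_1 w Hw).
Qed.

(** With [m = k - 1] the sign becomes [(-1) ^ (n - m)], equal to the [(-1) ^ (n + m)] of
    [ustirling1] because the exponents differ by [2 * m]. *)
Lemma b_lam_sum (lam : R) (a : nat -> C) (n : nat) :
  b_lam lam a n = sum_n (G := C_AbelianMonoid)
    (fun m => RtoC (lam ^ m) * a (S m) * RtoC (ustirling1 n m / INR (fact n)))%C n.
Proof.
  unfold b_lam. rewrite Nat.add_1_r.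
  rewrite <- (sum_n_m_S (G := C_AbelianMonoid)).
  change (sum_n (G := C_AbelianMonoid)
    (fun m => RtoC (lam ^ m) * a (S m) * RtoC (ustirling1 n m / INR (fact n)))%C n)
    with (sum_n_m (G := C_AbelianMonoid)
    (fun m => RtoC (lam ^ m) * a (S m) * RtoC (ustirling1 n m / INR (fact n)))%C 0 n).
  rewrite <- (sum_n_m_mult_l (K := C_Ring)).
  apply sum_n_m_ext_loc. intros m Hm.
  unfold a_lam, ustirling1.
  change (ssrnat.subn (S n) (S m)) with (n - m)%nat.
  replace (ssrnat.subn (S m) 1) with m by (symmetry; apply Nat.sub_0_r).
  replace ((-1) ^ (n + m)) with ((-1) ^ (n - m)).
  - unfold Rdiv. rewrite !RtoC_mult. unfold mult; simpl. ring.
  - replace (n + m)%nat with ((n - m) + 2 * m)%nat by lia.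
    rewrite pow_add, pow_1_even. ring.
Qed.

(* [b_lam n] is the [n]-th Taylor coefficient of [t |-> F (- lam * Clog (1 - t))]. *)
Lemma cmean_borel (a : nat -> C) (lam : R) (F : C -> C) (n : nat) (x : R) :
  gevrey1 a -> 0 < lam ->
  (forall w, Delta_lam lam w -> C_holo_at F w) ->
  (exists r, 0 < r /\ forall zeta, Cmod zeta < r -> Delta_lam lam zeta ->
     is_series (K := C_AbsRing) (V := C_NormedModule) (borel_term a zeta) (F zeta)) ->
  x < 0 ->
  strip_holo (fun w => F (RtoC lam * CL w) * Cpow (Cexp (- w)) n)%C /\
  cmean (fun w => F (RtoC lam * CL w) * Cpow (Cexp (- w)) n)%C x =
  (RtoC (2 * PI) * b_lam lam a n)%C.
Proof.
  intros Ha Hlam HF [r [Hr Hs]] Hx.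
  set (H := fun w => (F (RtoC lam * CL w) * Cpow (Cexp (- w)) n)%C).
  assert (HH : strip_holo H).
  { apply strip_holo_mult; [|apply strip_holo_Cexp_opp_pow].
    apply (strip_holo_comp F (fun w => RtoC lam * CL w)%C).
    - exact (strip_holo_mult _ _ (strip_holo_const (RtoC lam)) strip_holo_CL).
    - intros w Hw. apply HF, Delta_lam_CL, Hw. }
  split; [exact HH|].
  set (c := fun m => (RtoC (lam ^ m) * a (S m))%C).
  (* The terms of the truncated series times [t ^ (- n)], negated so that adding them to [H] leaves
     the remainder. *)
  set (f := fun m w => (- c m * (CLpow m w * Cpow (Cexp (- w)) n))%C).
  assert (Hm : forall m, strip_holo (fun w => CLpow m w * Cpow (Cexp (- w)) n)%C).
  { intros m. apply strip_holo_mult; [apply strip_holo_CLpow|apply strip_holo_Cexp_opp_pow]. }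
  assert (Hf : forall m, strip_holo (f m)).
  { intros m. exact (strip_holo_mult _ _ (strip_holo_const (- c m)%C) (Hm m)). }
  assert (Hrem : forall w, (H w + sum_n (G := C_AbelianMonoid) (fun m => f m w) n =
    (F (RtoC lam * CL w) - sum_n (G := C_AbelianMonoid) (borel_term a (RtoC lam * CL w)) n)
      * Cpow (Cexp (- w)) n)%C).
  { intros w. unfold H.
    replace (sum_n (G := C_AbelianMonoid) (fun m => f m w) n)
      with (- Cpow (Cexp (- w)) n *
        sum_n (G := C_AbelianMonoid) (borel_term a (RtoC lam * CL w)) n)%C.
    - ring.
    - symmetry. etransitivity; [|exact (sum_n_mult_l (K := C_Ring) (- Cpow (Cexp (- w)) n)%C
        (borel_term a (RtoC lam * CL w)) n)].
      apply sum_n_ext. intros m. unfold f, c, CLpow, borel_term, mult; simpl.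
      rewrite Cpow_mult_l, RtoC_pow. field. apply RtoC_INR_fact_neq_0. }
  assert (H0 : cmean (fun w => H w + sum_n (G := C_AbelianMonoid) (fun m => f m w) n)%C x = RtoC 0).
  { destruct (borel_tail_bound a n Ha) as [M [d [HM [Hd Ht]]]].
    set (rho := Rmin d r). assert (Hrho : 0 < rho) by (apply Rmin_glb_lt; assumption).
    assert (Hrl : 0 < rho / (4 * lam)) by (apply Rdiv_lt_0_compat; lra).
    (* The remainder is at most [M * (2 * lam * exp (Re w)) ^ S n]; after multiplication by
       [exp (- Re w) ^ n] one factor [exp (Re w)] survives, as [cmean_decay] demands. The threshold
       with [4 * lam] gives [|lam * CL w| <= rho / 2], inside both the disc of the tail bound and
       that of the series. *)
    apply (cmean_decay _ (M * (2 * lam) ^ S n) (Rmin (-1) (ln (rho / (4 * lam)))));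
      [|clear x Hx; intros w Hw|exact Hx].
    - apply strip_holo_plus; [exact HH|]. apply strip_holo_sum. exact Hf.
    - rewrite Hrem, Cmod_mult, Cmod_pow, Cmod_Cexp.
      assert (Hw1 : Re w <= -1) by (eapply Rle_trans; [exact Hw|apply Rmin_l]).
      assert (Hw2 : exp (Re w) <= rho / (4 * lam)).
      { rewrite <- (exp_ln _ Hrl). apply exp_le. eapply Rle_trans; [exact Hw|apply Rmin_r]. }
      assert (HL : Cmod (RtoC lam * CL w) <= 2 * lam * exp (Re w)).
      { rewrite Cmod_mult, Cmod_R, Rabs_right by lra.
        replace (2 * lam * exp (Re w)) with (lam * (2 * exp (Re w))) by ring.
        apply Rmult_le_compat_l; [lra|]. exact (Cmod_CL_linear w Hw1). }
      assert (HL2 : Cmod (RtoC lam * CL w) < rho).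
      { apply (Rmult_le_compat_l (2 * lam)) in Hw2; [|lra].
        replace (2 * lam * (rho / (4 * lam))) with (rho / 2) in Hw2 by (field; lra). lra. }
      assert (Hd1 := Rmin_l d r). assert (Hd2 := Rmin_r d r). fold rho in Hd1, Hd2.
      assert (HD := Delta_lam_CL lam w ltac:(lra)).
      specialize (Ht (RtoC lam * CL w)%C (F (RtoC lam * CL w)%C) ltac:(lra)
        (Hs (RtoC lam * CL w)%C ltac:(lra) HD)).
      assert (Hp : Cmod (RtoC lam * CL w) ^ S n <= (2 * lam * exp (Re w)) ^ S n)
        by (apply pow_incr; split; [apply Cmod_ge_0|exact HL]).
      assert (He : 0 < exp (Re (- w)) ^ n) by (apply pow_lt, exp_pos).
      assert (Hee : exp (Re w) ^ n * exp (Re (- w)%C) ^ n = 1).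
      { rewrite <- Rpow_mult_distr. replace (Re (- w)%C) with (- Re w) by reflexivity.
        rewrite <- exp_plus, Rplus_opp_r, exp_0. apply pow1. }
      eapply Rle_trans; [apply Rmult_le_compat_r; [lra|exact Ht]|].
      apply Rle_trans with (M * (2 * lam * exp (Re w)) ^ S n * exp (Re (- w)%C) ^ n).
      + apply Rmult_le_compat_r; [lra|]. apply Rmult_le_compat_l; [exact HM|exact Hp].
      + right. rewrite (Rpow_mult_distr (2 * lam)).
        transitivity (M * (2 * lam) ^ S n * exp (Re w) * (exp (Re w) ^ n * exp (Re (- w)%C) ^ n)).
        * simpl pow. ring.
        * rewrite Hee. ring. }
  rewrite cmean_plus in H0; [|exact HH|apply strip_holo_sum; exact Hf|exact Hx].
  rewrite cmean_sum in H0 by assumption.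
  rewrite (sum_n_ext _ (fun m => mult (K := C_Ring) (- RtoC (2 * PI))%C
    (c m * RtoC (ustirling1 n m / INR (fact n)))%C)) in H0.
  - rewrite (sum_n_mult_l (K := C_Ring)) in H0.
    unfold c in H0. rewrite <- b_lam_sum in H0. unfold mult in H0; simpl in H0.
    match type of H0 with (?z + - ?p * ?b)%C = _ =>
      replace z with ((z + - p * b) + p * b)%C by ring end.
    rewrite H0. ring.
  - intros m. unfold f. rewrite cmean_Cmult by (try apply Hm; exact Hx).
    rewrite cmean_CLpow by exact Hx. unfold mult; simpl. ring.
Qed.

(** Cauchy's estimate on the circle of radius [exp x], the factor [2 * PI] cancelling. The radius
    stays free because [n = 0] and [n > 0] call for different choices. *)
Lemma b_lam_cauchy (a : nat -> C) (lam A B : R) (F : C -> C) (n : nat) (x : R) :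
  gevrey1 a -> 0 < lam ->
  (forall w, Delta_lam lam w -> C_holo_at F w) ->
  (exists r, 0 < r /\ forall zeta, Cmod zeta < r -> Delta_lam lam zeta ->
     is_series (K := C_AbsRing) (V := C_NormedModule) (borel_term a zeta) (F zeta)) ->
  0 < A -> 0 < B ->
  (forall zeta, Delta_lam lam zeta -> Cmod (F zeta) <= A * exp (B * Cmod zeta)) ->
  x < 0 ->
  Cmod (b_lam lam a n) <= A * exp (lam * B * - ln (1 - exp x)) * exp (- x) ^ n.
Proof.
  intros Ha Hlam HF Hs HA HB Hb Hx.
  destruct (cmean_borel a lam F n x Ha Hlam HF Hs Hx) as [HH HE].
  assert (Hpi := PI_RGT_0).
  assert (Hc := cmean_bound _ x (A * exp (lam * B * - ln (1 - exp x)) * exp (- x) ^ n) HH Hx).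
  rewrite HE, Cmod_mult, Cmod_R, Rabs_right in Hc by lra.
  apply Rmult_le_reg_l with (2 * PI); [lra|]. apply Hc.
  intros y. rewrite Cmod_mult, Cmod_pow, Cmod_Cexp.
  apply Rmult_le_compat_r; [apply pow_le; left; apply exp_pos|].
  eapply Rle_trans; [apply Hb, Delta_lam_CL, Hx|].
  apply Rmult_le_compat_l; [lra|]. apply exp_le.
  rewrite Cmod_mult, Cmod_R, Rabs_right by lra.
  assert (HL := Cmod_CL (x, y) Hx). simpl in HL.
  replace (B * (lam * Cmod (CL (x, y)))) with (lam * B * Cmod (CL (x, y))) by ring.
  apply Rmult_le_compat_l; [|exact HL]. apply Rmult_le_pos; lra.
Qed.

Theorem lemma3p4 (a : nat -> C) (lam A B : R) (F : C -> C) :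
  gevrey1 a ->
  0 < lam ->
  (* F is holomorphic on Delta_lambda ... *)
  (forall w : C, Delta_lam lam w -> C_holo_at F w) ->
  (* ... and extends the Borel transform (agrees with its series near 0) *)
  (exists r : R, 0 < r /\
     forall zeta : C, Cmod zeta < r -> Delta_lam lam zeta ->
       is_series (K := C_AbsRing) (V := C_NormedModule) (borel_term a zeta) (F zeta)) ->
  0 < A -> 0 < B ->
  (forall zeta : C, Delta_lam lam zeta -> Cmod (F zeta) <= A * exp (B * Cmod zeta)) ->
  forall n : nat,
    Cmod (b_lam lam a n) <=
      A * Rpower (INR n + lam * B) (INR n + lam * B)
        / (Rpower (lam * B) (lam * B) * INR n ^ n).
Proof.
  intros Ha Hlam HF Hs HA HB Hb n.
  assert (HK := fun x Hx => b_lam_cauchy a lam A B F n x Ha Hlam HF Hs HA HB Hb Hx).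
  set (c := lam * B) in *. assert (Hc : 0 < c) by (apply Rmult_lt_0_compat; assumption).
  assert (HRc : 0 < Rpower c c) by apply exp_pos.
  destruct n as [|n].
  - simpl INR. rewrite Rplus_0_l. simpl pow in *.
    replace (A * Rpower c c / (Rpower c c * 1)) with A by (field; lra).
    destruct (Rle_lt_dec (Cmod (b_lam lam a 0)) A) as [H|H]; [exact H|exfalso].
    (* The contour radius tends to 0; this one already contradicts [H]. *)
    set (k := ln (Cmod (b_lam lam a 0) / A)).
    assert (Hk1 : 1 < Cmod (b_lam lam a 0) / A).
    { apply Rmult_lt_reg_r with A; [exact HA|]. unfold Rdiv. rewrite Rmult_assoc, Rinv_l; lra. }
    assert (Hk : 0 < k) by (unfold k; rewrite <- ln_1; apply ln_increasing; lra).
    assert (HE : Cmod (b_lam lam a 0) = A * exp k).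
    { unfold k. rewrite exp_ln by lra. field. lra. }
    assert (Hkc : 0 < k / (2 * c)) by (apply Rdiv_lt_0_compat; lra).
    assert (He1 : exp (- (k / (2 * c))) < 1) by (rewrite <- exp_0; apply exp_increasing; lra).
    assert (He0 := exp_pos (- (k / (2 * c)))).
    (* For this radius [r] one has [(1 - r) ^ (- c) = exp (k / 2)], while
       [Cmod (b_lam lam a 0) = A * exp k]. *)
    specialize (HK (ln (1 - exp (- (k / (2 * c)))))).
    rewrite exp_ln in HK by lra.
    replace (1 - (1 - exp (- (k / (2 * c))))) with (exp (- (k / (2 * c)))) in HK by ring.
    rewrite ln_exp in HK. replace (c * - - (k / (2 * c))) with (k / 2) in HK by (field; lra).
    rewrite HE, Rmult_1_r in HK.
    assert (HK' : A * exp k <= A * exp (k / 2)).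
    { apply HK. assert (Hl : ln (1 - exp (- (k / (2 * c)))) < ln 1) by (apply ln_increasing; lra).
      rewrite ln_1 in Hl. exact Hl. }
    apply Rmult_le_reg_l in HK'; [|exact HA].
    assert (exp (k / 2) < exp k) by (apply exp_increasing; lra). lra.
  - set (N := INR (S n)) in *.
    assert (HN : 0 < N) by (apply lt_0_INR; lia).
    (* The minimum of [(1 - r) ^ (- c) * r ^ (- n)] lies where [c / (1 - r) = n / r], that is at
       [r = n / (n + c)]. Its value is exactly the claimed bound, so only an equality remains. *)
    set (x := ln (N / (N + c))).
    assert (Hr : 0 < N / (N + c)) by (apply Rdiv_lt_0_compat; lra).
    assert (Hr1 : N / (N + c) < 1).
    { apply Rmult_lt_reg_r with (N + c); [lra|]. unfold Rdiv. rewrite Rmult_assoc, Rinv_l; lra. }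
    assert (Hx : x < 0) by (unfold x; rewrite <- ln_1; apply ln_increasing; lra).
    specialize (HK x Hx). eapply Rle_trans; [exact HK|]. right.
    rewrite exp_Ropp. unfold x. rewrite exp_ln by exact Hr.
    replace (1 - N / (N + c)) with (c / (N + c)) by (field; lra).
    rewrite ln_div by lra.
    (* The fifth [N] is the exponent in [Rpower (N + c) N]; unfolded to [INR (S n)], it becomes a
       natural power. *)
    rewrite Rpower_plus. unfold N at 5. rewrite Rpower_pow by lra. fold N.
    replace (/ (N / (N + c))) with ((N + c) * / N) by (field; lra).
    rewrite Rpow_mult_distr, pow_inv.
    replace (exp (c * - (ln c - ln (N + c)))) with (Rpower (N + c) c * / Rpower c c).
    + field. split; [apply pow_nonzero; lra|lra].
    + unfold Rpower. rewrite <- exp_Ropp, <- exp_plus. f_equal. ring.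
Qed.
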